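(* Let $T\sim\{X_n\}_{n=1}^\infty$ be a random weighted shift. If $N$ is a (deterministic) normal operator, then (i) $$\mathbb P(N\lhd T)=\begin{cases}1,&\text{if }\sigma(N)\subset\{z\in\mathbb C:|z|\in\operatorname{essran}X_1\},\\0,&\text{otherwise};\end{cases}$$ (ii) $$\mathbb P(T\lhd N)=\begin{cases}1,&\text{if }\operatorname{essran}X_1=\{0\}\subset\sigma(N),\\0,&\text{otherwise}.\end{cases}$$
   Context: $\mathcal H$ is a complex separable infinite-dimensional Hilbert space with orthonormal basis $\{e_n\}_{n=1}^\infty$. $\{X_n\}_{n=1}^\infty$ are nonnegative, bounded, i.i.d. random variables on a probability space $(\Omega,\mathcal F,\mathbb P)$. Writing $T\sim\{X_n\}$ means that $T=T(\omega)$ is the random unilateral weighted shift $T(\omega)e_n=X_n(\omega)e_{n+1}$, $n\ge1$. $\operatorname{essran}X_1$ is the essential range of $X_1$ (closed support of its law). $N$ is a bounded normal operator on a separable complex Hilbert space and $\sigma(N)$ is its spectrum. For Hilbert space operators $A,B$, $A\lhd B$ means $\|p(A,A^* )\|\le\|p(B,B^* )\|$ for all complex polynomials $p(x,y)$ in two free (noncommuting) variables (constant terms allowed). *)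

(* Defs.v *)
From HB Require Import structures.
From mathcomp Require Import all_boot all_order all_algebra sesquilinear.
From mathcomp Require Import finmap complex monalg.
From mathcomp Require Import all_classical all_reals all_analysis.
Import Order.TTheory GRing.Theory Num.Theory.
Import numFieldNormedType.Exports.

Set Implicit Arguments.
Unset Strict Implicit.
Unset Printing Implicit Defensive.

Local Open Scope classical_set_scope.
Local Open Scope ring_scope.

(* Complex Hilbert spaces. The inner product is linear in its first argument
   and conjugate-linear in its second one. The zero space is allowed. *)
HB.mixin Record isHilbert (R : realType) H of CompleteNormedModule R[i] H := {
  inner : {dot H for Num.conj};
  inner_norm : forall x : H, `|x| ^+ 2 = inner x x
}.

#[short(type="hilbertType")]
HB.structure Definition Hilbert (R : realType) :=
  {H of isHilbert R H & CompleteNormedModule R[i] H}.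

Definition separable (T : topologicalType) :=
  exists2 D : set T, countable D & dense D.

Section hilbert.
Context {R : realType} {H : hilbertType R}.

Definition orthonormal_basis (e : nat -> H) :=
  (forall i j, inner (e i) (e j) = (i == j)%:R) /\
  (forall x, series (fun n => inner x (e n) *: e n) @ \oo --> x).

(* The norm of H takes its values in the nonnegative elements of R[i], whence
   the real part. *)
Definition opnorm (A : H -> H) : \bar R :=
  ereal_sup [set (complex.Re `|A x|)%:E | x in [set x : H | `|x| <= 1]].

(* When A is a bounded operator, the vector z below exists (Riesz) and is
   unique. *)
Definition adjoint (A : H -> H) (y : H) : H :=
  xget 0 [set z : H | forall x, inner (A x) y = inner x z].

End hilbert.

Record bounded_operator (R : realType) (H : hilbertType R) := BoundedOperator {
  operator_fun :> {linear H -> H};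
  operator_bounded : exists M : R[i], forall x, `|operator_fun x| <= M * `|x|
}.

Section operators.
Context {R : realType}.

Definition normal_operator (H : hilbertType R) (A : bounded_operator H) :=
  forall x, A (adjoint A x) = adjoint A (A x).

Definition spectrum (H : hilbertType R) (A : bounded_operator H) : set R[i] :=
  [set z | ~ exists S : bounded_operator H,
     (forall x, S (A x - z *: x) = x) /\ (forall x, A (S x) - z *: S x = x)].

(* Complex polynomials in two noncommuting variables, i.e. the monoid algebra
   of the free monoid on two letters: false stands for x and true for y. *)
Definition ncpoly := {malg R[i][{fmonom bool}]}.

Definition word_eval (H : hilbertType R) (A B : H -> H) (w : seq bool) : H -> H :=
  fun v => foldr (fun b u => if b then B u else A u) v w.

Definition ncpoly_eval (H : hilbertType R) (p : ncpoly) (A B : H -> H) : H -> H :=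
  fun v => \sum_(w <- msupp p) p@_w *: word_eval A B w v.

Definition lhd (H K : hilbertType R)
    (A : bounded_operator H) (B : bounded_operator K) :=
  forall p : ncpoly,
    (opnorm (ncpoly_eval p A (adjoint A)) <=
     opnorm (ncpoly_eval p B (adjoint B)))%E.

End operators.

Section probability.
Context {d : measure_display} {Omega : measurableType d} {R : realType}
  (P : probability Omega R).

Definition mutually_independent (X : nat -> {RV P >-> R}) :=
  forall (s : {fset nat}) (A : nat -> set R),
    (forall n, measurable (A n)) ->
    P (\bigcap_(n in [set` s]) (X n @^-1` A n)) =
    (\prod_(n <- s) P (X n @^-1` A n))%E.

Definition identically_distributed (X : nat -> {RV P >-> R}) :=
  forall n (A : set R), measurable A ->
    distribution P (X n) A = distribution P (X 0%N) A.

Definition essran (X : {RV P >-> R}) : set R :=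
  [set t | forall U : set R, open U -> U t -> (0 < distribution P X U)%E].

(* With the numbering from 0: X n is the weight on the arrow e n -> e n.+1. *)
Definition random_weighted_shift (H : hilbertType R) (e : nat -> H)
    (X : nat -> {RV P >-> R}) (T : Omega -> bounded_operator H) :=
  forall omega n, T omega (e n) = (X n omega)%:C%C *: e n.+1.

End probability.

(* Main.v *)
Require Import Defs.
From HB Require Import structures.
From mathcomp Require Import all_boot all_order all_algebra sesquilinear.
From mathcomp Require Import finmap complex monalg.
From mathcomp Require Import all_classical all_reals all_analysis.
From mathcomp Require Import measurable_realfun ring lra.
Import Order.TTheory GRing.Theory Num.Theory.
Import numFieldNormedType.Exports.

Set Implicit Arguments.
Unset Strict Implicit.
Unset Printing Implicit Defensive.

Local Open Scope classical_set_scope.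
Local Open Scope ring_scope.

(** The proof turns both relations into conditions on the weights of a single
    realisation of the shift, and then computes their probabilities.

    Call [l] a joint approximate eigenvalue of [A] if some vectors are almost
    eigenvectors of [A] for [l] and at the same time of the adjoint of [A] for
    the conjugate of [l]. Evaluation at such a point is bounded by the norm of
    the polynomial in [A] ([joint_approx_value_le]), and conversely a point
    whose evaluations are so bounded is a joint approximate eigenvalue: otherwise
    [Q = (A - l)^* (A - l) + (A - l) (A - l)^*] is bounded below by a positive
    constant and [M - Q], for a large scalar [M], separates
    ([joint_approx_of_value_le]). For a normal [N] these points form the spectrum
    ([spectrum_normalP]), and every polynomial in [N] attains its norm at one of
    them ([normal_opnorm_attained]). That last fact replaces the functional
    calculus; it is obtained from the power method, which produces common
    approximate eigenvectors of commuting symmetric operators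
    ([approx_kernel_extend]). Hence [N] is dominated by [B] if and only if each
    point of the spectrum of [N] is a joint approximate eigenvalue of [B]
    ([lhd_normalP]).

    For a weighted shift, a joint approximate eigenvalue [l] must be
    approached in modulus by the weights, because [T^* T] is diagonal
    ([weight_near_joint_approx]); and [l] is one as soon as there are arbitrarily
    long windows of weights close to [|l|] ([joint_approx_of_windows]). With
    independent identically distributed weights such windows exist almost surely
    for all [|l|] in the support of the law ([ae_joint_approx]), while outside the
    support a neighbourhood of [|l|] is almost surely never visited. This gives
    the first zero-one law. The event is measurable because it only
    needs to be tested on countably many vectors and scalars
    ([measurable_joint_approx]).

    For the second law, if [T] is dominated by the normal operator [N] then the
    commutator of [T] and its adjoint vanishes. A normal unilateral weighted shift
    is zero, so the event is that all weights vanish, provided that [0] lies in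
    the spectrum of [N], and it is empty otherwise ([lhd_shift_normalP]). *)

(** * Norm and inner product with real values *)

Section RealNorm.
Context {R : realType}.

(** The norms of the statement live in the ordered field [R[i]]; this is the
    same norm with values in [R], where linear arithmetic is available. *)
Definition rnorm {V : normedZmodType R[i]} (v : V) : R := complex.Re `|v|.

Section Zmod.
Context {V : normedZmodType R[i]}.
Implicit Types u v : V.

Lemma rnormE v : (rnorm v)%:C%C = `|v|.
Proof. exact: (RRe_real (normr_real v)). Qed.

Lemma rnorm_ge0 v : 0 <= rnorm v.
Proof. by rewrite -lecR rnormE normr_ge0. Qed.

Lemma rnorm0 : rnorm (0 : V) = 0.
Proof. by rewrite /rnorm normr0. Qed.

Lemma rnormN v : rnorm (- v) = rnorm v.
Proof. by rewrite /rnorm normrN. Qed.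

Lemma rnormB u v : rnorm (u - v) = rnorm (v - u).
Proof. by rewrite /rnorm distrC. Qed.

Lemma rnormD u v : rnorm (u + v) <= rnorm u + rnorm v.
Proof. by rewrite -lecR rmorphD /= !rnormE ler_normD. Qed.

Lemma rnorm_eq0 v : rnorm v = 0 -> v = 0.
Proof. by move=> h; apply/normr0_eq0; rewrite -rnormE h. Qed.

Lemma rnorm_gt0 v : v != 0 -> 0 < rnorm v.
Proof.
by move=> v0; rewrite lt_def rnorm_ge0 andbT; apply: contraNneq v0 => /rnorm_eq0 ->.
Qed.

Lemma rnorm_sum I (r : seq I) (F : I -> V) :
  rnorm (\sum_(i <- r) F i) <= \sum_(i <- r) rnorm (F i).
Proof.
elim/big_rec2: _ => [|i y x _ h]; first by rewrite rnorm0.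
by apply: (le_trans (rnormD _ _)); rewrite lerD2l.
Qed.

End Zmod.

Lemma rnormM (a b : R[i]) : rnorm (a * b) = rnorm a * rnorm b.
Proof. by apply: (@complexI R); rewrite rmorphM /= !rnormE normrM. Qed.

Lemma rnormZ (H : normedModType R[i]) a (v : H) : rnorm (a *: v) = rnorm a * rnorm v.
Proof. by apply: (@complexI R); rewrite rmorphM /= !rnormE normrZ. Qed.

Lemma rnorm1 : rnorm (1 : R[i]) = 1.
Proof. by rewrite /rnorm normr1. Qed.

Lemma rnormX (a : R[i]) n : rnorm (a ^+ n) = rnorm a ^+ n.
Proof.
by elim: n => [|n IH]; rewrite ?rnorm1 // !exprS rnormM IH.
Qed.

Lemma rnorm_real (a : R) : rnorm (a%:C%C) = `|a|.
Proof. by rewrite /rnorm normc_def /= expr0n addr0 sqrtr_sqr. Qed.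

Lemma rnorm_conj (a : R[i]) : rnorm (a^*) = rnorm a.
Proof. by rewrite /rnorm norm_conjC. Qed.

Lemma rnorm_sqr (a : R[i]) : rnorm a ^+ 2 = complex.Re a ^+ 2 + complex.Im a ^+ 2.
Proof. by apply: (@complexI R); rewrite rmorphXn /= rnormE add_Re2_Im2. Qed.

Lemma mul_conj_rnorm (a : R[i]) : a * a^* = (rnorm a ^+ 2)%:C%C.
Proof. by rewrite rmorphXn /= rnormE normCK. Qed.

Lemma Re_le_rnorm (a : R[i]) : complex.Re a <= rnorm a.
Proof.
apply: le_trans (ler_norm _) _.
by rewrite -lecR rnormE; exact: normc_ge_Re.
Qed.

Lemma cRe_conj (a : R[i]) : complex.Re a^* = complex.Re a.
Proof. by case: a. Qed.

Lemma conj_real (a : R) : (a%:C%C : R[i])^* = a%:C%C.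
Proof. exact: conjc_real. Qed.

Lemma cReD (a b : R[i]) : complex.Re (a + b) = complex.Re a + complex.Re b.
Proof. by case: a b => ? ? []. Qed.

Lemma cReN (a : R[i]) : complex.Re (- a) = - complex.Re a.
Proof. by case: a. Qed.

Lemma cReZ (a : R) (b : R[i]) : complex.Re (a%:C%C * b) = a * complex.Re b.
Proof. by case: b => ? ? /=; rewrite mul0r subr0. Qed.

End RealNorm.

Section Inner.
Context {R : realType} {H : hilbertType R}.
Implicit Types (x y z : H) (a : R[i]).

Lemma innerDl x y z : inner (x + y) z = inner x z + inner y z.
Proof. exact: linearDl. Qed.
Lemma innerDr x y z : inner z (x + y) = inner z x + inner z y.
Proof. exact: linearDr. Qed.
Lemma innerNl x z : inner (- x) z = - inner x z.
Proof. exact: linearNl. Qed.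
Lemma innerNr x z : inner z (- x) = - inner z x.
Proof. exact: linearNr. Qed.
Lemma innerBl x y z : inner (x - y) z = inner x z - inner y z.
Proof. by rewrite innerDl innerNl. Qed.
Lemma innerBr x y z : inner z (x - y) = inner z x - inner z y.
Proof. by rewrite innerDr innerNr. Qed.
Lemma innerZl a x z : inner (a *: x) z = a * inner x z.
Proof. exact: linearZl_LR. Qed.
Lemma innerZr a x z : inner z (a *: x) = a^* * inner z x.
Proof. exact: linearZr_LR. Qed.
Lemma inner0l x : inner 0 x = 0.
Proof. exact: linear0l. Qed.
Lemma inner0r x : inner x 0 = 0.
Proof. exact: linear0r. Qed.
Lemma innerC x y : inner x y = (inner y x)^*.
Proof. by rewrite hermC expr0 mul1r. Qed.
Lemma inner_suml I (r : seq I) (F : I -> H) z :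
  inner (\sum_(i <- r) F i) z = \sum_(i <- r) inner (F i) z.
Proof. exact: linear_sumlz. Qed.

Lemma innerxx x : inner x x = (rnorm x ^+ 2)%:C%C.
Proof. by rewrite rmorphXn /= rnormE inner_norm. Qed.

Definition rinner x y : R := complex.Re (inner x y).

Lemma rinnerxx x : rinner x x = rnorm x ^+ 2.
Proof. by rewrite /rinner innerxx. Qed.
Lemma rinnerC x y : rinner x y = rinner y x.
Proof. by rewrite /rinner innerC cRe_conj. Qed.
Lemma rinnerDl x y z : rinner (x + y) z = rinner x z + rinner y z.
Proof. by rewrite /rinner innerDl cReD. Qed.
Lemma rinnerDr x y z : rinner z (x + y) = rinner z x + rinner z y.
Proof. by rewrite /rinner innerDr cReD. Qed.
Lemma rinnerNl x z : rinner (- x) z = - rinner x z.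
Proof. by rewrite /rinner innerNl cReN. Qed.
Lemma rinnerNr x z : rinner z (- x) = - rinner z x.
Proof. by rewrite /rinner innerNr cReN. Qed.
Lemma rinnerZl (a : R) x z : rinner (a%:C%C *: x) z = a * rinner x z.
Proof. by rewrite /rinner innerZl cReZ. Qed.
Lemma rinnerZr (a : R) x z : rinner z (a%:C%C *: x) = a * rinner z x.
Proof. by rewrite /rinner innerZr conj_real cReZ. Qed.

Lemma rnormD_sqr x y :
  rnorm (x + y) ^+ 2 = rnorm x ^+ 2 + 2 * rinner x y + rnorm y ^+ 2.
Proof.
by rewrite -!rinnerxx rinnerDl !rinnerDr (rinnerC y x); ring.
Qed.

Lemma rnormB_sqr x y :
  rnorm (x - y) ^+ 2 = rnorm x ^+ 2 - 2 * rinner x y + rnorm y ^+ 2.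
Proof. by rewrite rnormD_sqr rinnerNr rnormN; ring. Qed.

Lemma cauchy_schwarz x y : rnorm (inner x y) <= rnorm x * rnorm y.
Proof.
have [->|/rnorm_gt0 y0] := eqVneq y 0; first by rewrite inner0r !rnorm0 mulr0.
(* [b x - c y] below is [b] times the component of [x] orthogonal to [y] *)
set c := inner x y; set b := rnorm y ^+ 2.
have b0 : 0 < b by rewrite exprn_gt0.
have := rinnerxx (b%:C%C *: x - c *: y); rewrite /rinner => E.
have {}E : b * (b * rnorm x ^+ 2 - rnorm c ^+ 2) =
    rnorm (b%:C%C *: x - c *: y) ^+ 2.
  rewrite -E innerBl !innerBr !innerZl !innerZr !innerxx -/c -/b (innerC y x) -/c.
  rewrite conj_real.
  have -> : c * (b%:C%C * c^*) = b%:C%C * (c * c^*) by ring.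
  have -> : b%:C%C * (c^* * c) = b%:C%C * (c * c^*) by ring.
  have -> : c * (c^* * b%:C%C) = b%:C%C * (c * c^*) by ring.
  by rewrite mul_conj_rnorm -!rmorphM -!rmorphB /=; ring.
have h : 0 <= b * rnorm x ^+ 2 - rnorm c ^+ 2.
  by rewrite -(pmulr_rge0 _ b0) E exprn_ge0 // rnorm_ge0.
rewrite -(@ler_pXn2r _ 2) ?nnegrE ?mulr_ge0 ?rnorm_ge0 //.
by rewrite exprMn -/b mulrC -subr_ge0.
Qed.

Lemma rinner_le x y : rinner x y <= rnorm x * rnorm y.
Proof. exact: le_trans (Re_le_rnorm _) (cauchy_schwarz _ _). Qed.

(** Below, vector identities are proved by pairing both sides with an arbitrary
    vector: they become identities between scalars, within reach of [ring]. *)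
Lemma inner_ext x y : (forall z, inner x z = inner y z) -> x = y.
Proof.
move=> h; apply/subr0_eq/rnorm_eq0/eqP.
by rewrite -sqrf_eq0 -rinnerxx /rinner innerBl h subrr.
Qed.

Lemma inner_extr x y : (forall z, inner z x = inner z y) -> x = y.
Proof. by move=> h; apply: inner_ext => z; rewrite innerC h -innerC. Qed.

End Inner.

Section Convergence.
Context {R : realType}.

Lemma gt0_complex (e : R[i]) : 0 < e -> exists2 r : R, 0 < r & e = r%:C%C.
Proof.
case: e => a b; rewrite ltcE /= => /andP[/eqP -> a0].
by exists a.
Qed.

Lemma cvg_rnorm (V : normedModType R[i]) (u : nat -> V) (l : V) :
  u @ \oo --> l <->
  (forall e : R, 0 < e -> exists N, forall n, (N <= n)%N -> rnorm (l - u n) < e).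
Proof.
split.
- move/cvgrPdist_lt => h e e0.
  have /h[N _ hN] : 0 < e%:C%C by rewrite ltcR.
  by exists N => n /hN; rewrite /= -rnormE ltcR.
- move=> h; apply/cvgrPdist_lt => e /gt0_complex[r /h[N hN] ->].
  by exists N => // n /= /hN; rewrite -rnormE ltcR.
Qed.

Lemma cauchy_rnorm (V : completeNormedModType R[i]) (u : nat -> V) :
  (forall e : R, 0 < e -> exists N, forall m n, (N <= m)%N -> (N <= n)%N ->
     rnorm (u m - u n) < e) ->
  exists l : V, u @ \oo --> l.
Proof.
move=> h.
suff : cvg (u @ \oo) by move=> /cvg_ex.
apply: cauchy_cvg; apply: cauchy_exP => _ /gt0_complex[e /h[N hN] ->].
exists (u N); exists N => // n /= Nn.
by rewrite -ball_normE /ball_ /= -rnormE ltcR; exact: hN.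
Qed.

End Convergence.

(** * Bounded operators, the Riesz representation and adjoints *)

Section LinearBounded.
Context {R : realType} {H : hilbertType R}.
Implicit Types (A B : H -> H) (x y z : H).

(** Boundedness as a predicate on plain functions: adjoints and polynomial
    expressions are functions, so no structure has to be rebuilt for them. *)
Definition linear_bounded A :=
  (forall (a : R[i]) x y, A (a *: x + y) = a *: A x + A y) /\
  (exists2 M : R, 0 <= M & forall x, rnorm (A x) <= M * rnorm x).

Lemma bounded_operatorP (A : bounded_operator H) : linear_bounded A.
Proof.
split; first by move=> a x y; rewrite linearP.
have [M hM] := operator_bounded A.
exists (rnorm M) => [|x]; first exact: rnorm_ge0.
rewrite -rnormZ -lecR !rnormE normrZ.
apply: le_trans (hM x) _; rewrite -[X in _ <= _ * X]normr_id -normrM.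
by apply: real_ler_norm; rewrite ger0_real // (le_trans _ (hM x)).
Qed.

Lemma linear_boundedD A : linear_bounded A -> forall x y, A (x + y) = A x + A y.
Proof. by move=> [h _] x y; rewrite -{1}(scale1r x) h scale1r. Qed.

Lemma linear_bounded0 A : linear_bounded A -> A 0 = 0.
Proof.
move=> hA; have := linear_boundedD hA 0 0; rewrite addr0 => /esym/eqP.
by rewrite -subr_eq0 addrK => /eqP.
Qed.

Lemma linear_boundedZ A : linear_bounded A -> forall a x, A (a *: x) = a *: A x.
Proof.
by move=> hA a x; have [h _] := hA; rewrite -{1}(addr0 (a *: x)) h linear_bounded0 ?addr0.
Qed.

Lemma linear_boundedN A : linear_bounded A -> forall x, A (- x) = - A x.
Proof. by move=> hA x; rewrite -scaleN1r linear_boundedZ // scaleN1r. Qed.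

Lemma linear_boundedB A : linear_bounded A -> forall x y, A (x - y) = A x - A y.
Proof. by move=> hA x y; rewrite linear_boundedD // linear_boundedN. Qed.

Lemma linear_bounded_sum A (hA : linear_bounded A) I (r : seq I) (F : I -> H) :
  A (\sum_(i <- r) F i) = \sum_(i <- r) A (F i).
Proof.
elim/big_rec2: _ => [|i y x _ <-]; first by rewrite linear_bounded0.
by rewrite linear_boundedD.
Qed.

Lemma linear_bounded_add A B :
  linear_bounded A -> linear_bounded B -> linear_bounded (fun x => A x + B x).
Proof.
move=> [hA [M M0 hM]] [hB [L L0 hL]]; split=> [a x y|].
  by rewrite hA hB scalerDr addrACA.
exists (M + L) => [|x]; first exact: addr_ge0.
by rewrite mulrDl; apply: le_trans (rnormD _ _) (lerD _ _).
Qed.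

Lemma linear_bounded_scale a A : linear_bounded A -> linear_bounded (fun x => a *: A x).
Proof.
move=> [hA [M M0 hM]]; split=> [b x y|].
  by rewrite hA scalerDr !scalerA mulrC.
exists (rnorm a * M) => [|x]; first by rewrite mulr_ge0 ?rnorm_ge0.
by rewrite rnormZ -mulrA ler_wpM2l ?rnorm_ge0.
Qed.

Lemma linear_bounded_id : linear_bounded (fun x => x).
Proof. by split=> //; exists 1 => // x; rewrite mul1r. Qed.

Lemma linear_bounded_zero : linear_bounded (fun _ : H => 0 : H).
Proof.
split; first by move=> a x y; rewrite scaler0 addr0.
by exists 0 => // x; rewrite rnorm0 mul0r.
Qed.

Lemma linear_bounded_comp A B :
  linear_bounded A -> linear_bounded B -> linear_bounded (fun x => A (B x)).
Proof.
move=> [hA [M M0 hM]] [hB [L L0 hL]]; split=> [a x y|].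
  by rewrite hB hA.
exists (M * L) => [|x]; first exact: mulr_ge0.
by apply: le_trans (hM _) _; rewrite -mulrA ler_wpM2l.
Qed.

Lemma linear_bounded_shift A (l : R[i]) :
  linear_bounded A -> linear_bounded (fun x => A x - l *: x).
Proof.
move=> hA; have := linear_bounded_add hA (linear_bounded_scale (- l) linear_bounded_id).
by under eq_fun do rewrite scaleNr.
Qed.

End LinearBounded.

Section LaxMilgram.
Context {R : realType} {H : hilbertType R}.
Implicit Types x y z h : H.
Variables (Q : H -> H) (c : R) (f : H -> R[i]) (K : R).
Hypothesis hQ : linear_bounded Q.
Hypothesis Qsym : forall x y, inner (Q x) y = inner x (Q y).
Hypothesis c_gt0 : 0 < c.
Hypothesis Qcoercive : forall x, c * rnorm x ^+ 2 <= rinner (Q x) x.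
Hypothesis f_linear : forall (a : R[i]) x y, f (a *: x + y) = a * f x + f y.
Hypothesis f_bounded : forall x, rnorm (f x) <= K * rnorm x.

Let J x := rinner (Q x) x - 2 * complex.Re (f x).

Let J_line x h (t : R) :
  J (x + t%:C%C *: h) =
  J x + 2 * t * (rinner (Q x) h - complex.Re (f h)) + t ^+ 2 * rinner (Q h) h.
Proof.
rewrite /J (addrC x) f_linear cReD cReZ linear_boundedD // linear_boundedZ //.
rewrite !rinnerDl !rinnerDr !rinnerZl !rinnerZr.
have -> : rinner (Q h) x = rinner (Q x) h by rewrite /rinner Qsym innerC cRe_conj.
by ring.
Qed.

Let J_lb x : - (K ^+ 2 / c) <= J x.
Proof.
have h1 := Qcoercive x; have h2 := f_bounded x; have h3 := Re_le_rnorm (f x).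
rewrite lerNl /J ler_pdivlMr //.
have {}h3 := le_trans h3 h2.
have h4 : 0 <= (c * rnorm x - K) ^+ 2 by exact: sqr_ge0.
have h5 := ler_wpM2l (ltW c_gt0) h1; have h6 := ler_wpM2l (ltW c_gt0) h3.
move: h4 h5 h6; set q := rinner _ _; set g := complex.Re _; set r := rnorm x.
nra.
Qed.

Let S := [set J x | x in [set: H]].

Let S_inf : has_inf S.
Proof.
split; first by exists (J 0); exists 0.
by exists (- (K ^+ 2 / c)) => _ [x _ <-]; exact: J_lb.
Qed.

Let m := inf S.

Let m_le x : m <= J x.
Proof. by apply: ge_inf; [case: S_inf | exists x]. Qed.

(** A minimising sequence of the energy [J] is Cauchy by the parallelogram
    identity, and the Euler equation of its limit is the claim. *)
Lemma lax_milgram : exists z, forall x, f x = inner (Q x) z.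
Proof.
have /choice[u hu] : forall n : nat, exists x, J x < m + n.+1%:R^-1.
  move=> n; have n0 : 0 < n.+1%:R^-1 :> R by rewrite invr_gt0.
  by have [_ [x _ <-] hx] := inf_adherent n0 S_inf; exists x.
have ucauchy p q : c * rnorm (u p - u q) ^+ 2 <= 2 * (p.+1%:R^-1 + q.+1%:R^-1).
  have h1 := m_le (u q + (2^-1)%:C%C *: (u p - u q)).
  have h2 := J_line (u q) (u p - u q) 1.
  rewrite J_line in h1; rewrite scale1r subrKC in h2.
  have := Qcoercive (u p - u q); have := hu p; have := hu q.
  move: h1 h2; set D := _ - complex.Re _; set b := rinner _ (_ - _).
  move: p.+1%:R^-1 q.+1%:R^-1 (J (u p)) (J (u q)) => a a' jp jq.
  rewrite divff ?pnatr_eq0 // mulr1 mul1r expr1n mul1r => h1 h2 h3 h4 h5.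
  have e4 : (2^-1 : R) ^+ 2 = 4^-1 by field.
  rewrite e4 in h1.
  lra.
have inv_lt (e : R) : 0 < e -> exists N, forall n, (N <= n)%N -> n.+1%:R^-1 < e.
  move=> e0; have [N hN] := ltr_add_invr (y := 0) (x := e) e0.
  rewrite add0r in hN; exists N => n Nn; apply: le_lt_trans hN.
  by rewrite lef_pV2 ?posrE // ler_nat ltnS.
have [z /cvg_rnorm hz] : exists z : H, u @ \oo --> z.
  apply: cauchy_rnorm => e e0.
  have [|N hN] := inv_lt (c * e ^+ 2 / 4).
    by rewrite divr_gt0 // mulr_gt0 // exprn_gt0.
  exists N => p q /hN hp /hN hq.
  rewrite -(@ltr_pXn2r _ 2) ?nnegrE ?rnorm_ge0 ?(ltW e0) //.
  rewrite -(ltr_pM2l c_gt0); move: hp hq (ucauchy p q).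
  move: p.+1%:R^-1 q.+1%:R^-1 => a a'.
  by lra.
(* [J] is minimal at [z]: the quadratic polynomial [2 t D + t ^ 2 b] is
   nonnegative for all real [t], which forces its slope [D] to vanish *)
have euler h : rinner (Q z) h = complex.Re (f h).
  set b := rinner (Q h) h.
  have b0 : 0 <= b by apply: le_trans (Qcoercive h); rewrite mulr_ge0 ?sqr_ge0 // ltW.
  set D := rinner (Q z) h - complex.Re (f h).
  suff : D = 0 by move/eqP; rewrite subr_eq0 => /eqP.
  have pos (t : R) : 0 <= 2 * t * D + t ^+ 2 * b.
    apply/ler_addgt0Pr => e e0; rewrite -lerBlDr sub0r.
    have [_ [M M0 hM]] := hQ.
    have [N1 hN1] := inv_lt (e / 2) (divr_gt0 e0 (ltr0Sn _ _)).
    set L := 2 * `|t| * M * rnorm h + 1.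
    have L0 : 0 < L.
      by rewrite ltr_wpDl // !mulr_ge0 // rnorm_ge0.
    have [N2 hN2] := hz (e / 2 / L) (divr_gt0 (divr_gt0 e0 (ltr0Sn _ _)) L0).
    set n := maxn N1 N2.
    have h1 := hN1 n (leq_maxl _ _); have h2 := hN2 n (leq_maxr _ _).
    have h3 := m_le (u n + t%:C%C *: h); rewrite J_line -/b in h3.
    have h4 := hu n.
    have h5 : 2 * t * (rinner (Q (u n)) h - rinner (Q z) h) <= e / 2.
      rewrite -rinnerNl -rinnerDl -linear_boundedB //.
      apply: le_trans (ler_norm _) _; rewrite 2!normrM ger0_norm //.
      have h6 : `|rinner (Q (u n - z)) h| <= M * rnorm (z - u n) * rnorm h.
        rewrite ler_norml lerNl -rinnerNl -(linear_boundedN hQ) opprB.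
        apply/andP; split; apply: le_trans (rinner_le _ _) _.
          by rewrite ler_wpM2r ?rnorm_ge0.
        by rewrite (rnormB z) ler_wpM2r ?rnorm_ge0.
      apply: le_trans (ler_wpM2l _ h6) _; first by rewrite mulr_ge0.
      rewrite ltr_pdivlMr // in h2.
      apply: le_trans (ltW h2).
      rewrite (_ : 2 * `|t| * _ = rnorm (z - u n) * (L - 1)); last by rewrite /L; ring.
      by rewrite ler_wpM2l ?rnorm_ge0 // gerBl.
    move: h1 h3 h4 h5; rewrite /D; move: n.+1%:R^-1 (J (u n)) => a j.
    move: (rinner (Q (u n)) h) (rinner (Q z) h) (complex.Re (f h)) => r r' g.
    by move=> *; lra.
  have := pos (- D / (b + 1)).
  have b1 : 0 < b + 1 by rewrite ltr_wpDl.
  rewrite (_ : _ + _ = - (D ^+ 2 * ((b + 2) / (b + 1) ^+ 2))); last first.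
    by field; rewrite gt_eqF.
  rewrite oppr_ge0 pmulr_lle0; last by rewrite divr_gt0 ?exprn_gt0 // ltr_wpDl.
  by move=> D2; apply/eqP; rewrite -sqrf_eq0 eq_le D2 sqr_ge0.
exists z => x.
(* equal real parts for [x] and for ['i x] give equality of complex numbers *)
have re y : complex.Re (f y) = complex.Re (inner (Q y) z).
  by rewrite -euler /rinner Qsym innerC cRe_conj.
have f0 y a : f (a *: y) = a * f y.
  have f00 : f 0 = 0.
    have := f_linear 1 0 0; rewrite scale1r mul1r addr0 => /eqP.
    by rewrite -subr_eq0 opprD addrA subrr sub0r oppr_eq0 => /eqP.
  by rewrite -{1}(addr0 (a *: y)) f_linear f00 addr0.
have := re ('i%C *: x); rewrite f0 linear_boundedZ // innerZl.
have := re x; case: (f x) (inner (Q x) z) => a b [a' b'] /= ->.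
by rewrite !mul0r !mul1r !sub0r => /oppr_inj ->.
Qed.

End LaxMilgram.

Section Adjoint.
Context {R : realType} {H : hilbertType R}.
Implicit Types (A B : H -> H) (x y z : H).

(** The Riesz representation of [x |-> <A x, y>] is the case of the identity
    operator in [lax_milgram]. *)
Lemma adjointP A : linear_bounded A ->
  forall x y, inner (A x) y = inner x (adjoint A y).
Proof.
move=> hA x y; have [hA1 [M M0 hM]] := hA.
rewrite /adjoint; case: xgetP => [z _ /(_ x) //|none].
have [||||||z hz] := @lax_milgram R H (fun x => x) 1 (fun x => inner (A x) y) (M * rnorm y).
- exact: linear_bounded_id.
- by [].
- exact: ltr01.
- by move=> v; rewrite mul1r rinnerxx.
- by move=> a v w; rewrite hA1 innerDl innerZl.
- move=> v; apply: le_trans (cauchy_schwarz _ _) _.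
  by rewrite mulrAC ler_wpM2r ?rnorm_ge0.
by have := none z; elim.
Qed.

Lemma adjoint_unique A y z : linear_bounded A ->
  (forall x, inner (A x) y = inner x z) -> adjoint A y = z.
Proof. by move=> hA h; apply: inner_extr => x; rewrite -adjointP. Qed.

Lemma inner_adjointl A : linear_bounded A ->
  forall x y, inner (adjoint A x) y = inner x (A y).
Proof. by move=> hA x y; rewrite innerC -adjointP // -innerC. Qed.

Lemma adjoint_bound A M : linear_bounded A -> 0 <= M ->
  (forall x, rnorm (A x) <= M * rnorm x) ->
  forall x, rnorm (adjoint A x) <= M * rnorm x.
Proof.
move=> hA M0 hM x; set y := adjoint A x.
have [->|/rnorm_gt0 y0] := eqVneq y 0; first by rewrite rnorm0 mulr_ge0 ?rnorm_ge0.
rewrite -(ler_pM2r y0) -expr2 -rinnerxx /rinner -adjointP //.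
apply: le_trans (rinner_le _ _) _.
by rewrite mulrAC ler_wpM2r ?rnorm_ge0.
Qed.

Lemma linear_bounded_adjoint A : linear_bounded A -> linear_bounded (adjoint A).
Proof.
move=> hA; split=> [a x y|].
  by apply: inner_ext => z; rewrite innerDl innerZl !inner_adjointl // innerDl innerZl.
by have [_ [M M0 hM]] := hA; exists M => //; exact: adjoint_bound.
Qed.

End Adjoint.

(** * Noncommutative polynomials and the operator norm *)

Section PolyEval.
Context {R : realType}.

Section Linear.
Context {V : lmodType R[i]} (F : {fmonom bool} -> V).

Let lin (p : @ncpoly R) : V := \sum_(w <- msupp p) p@_w *: F w.

Lemma ncpoly_lin_wide (d : {fset {fmonom bool}}) (p : @ncpoly R) :
  (msupp p `<=` d)%fset -> lin p = \sum_(w <- d) p@_w *: F w.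
Proof.
move=> pd; rewrite /lin (big_fset_incl _ pd) //.
by move=> w _ /mcoeff_outdom ->; rewrite scale0r.
Qed.

Lemma ncpoly_linD (p q : @ncpoly R) : lin (p + q) = lin p + lin q.
Proof.
rewrite (ncpoly_lin_wide (msuppD_le p q)) (ncpoly_lin_wide (fsubsetUl _ (msupp q))).
rewrite (ncpoly_lin_wide (fsubsetUr (msupp p) _)) -big_split /=.
by apply: eq_bigr => w _; rewrite mcoeffD scalerDl.
Qed.

Lemma ncpoly_linU (c : R[i]) w : lin << c *g w >> = c *: F w.
Proof.
by rewrite (ncpoly_lin_wide msuppU_le) big_seq_fset1 mcoeffUU.
Qed.

End Linear.

Definition word_value (l : R[i]) (w : seq bool) : R[i] :=
  foldr (fun b u => (if b then l^* else l) * u) 1 w.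

(** The value of a polynomial at the one-dimensional operator [l]. *)
Definition ncpoly_value (l : R[i]) (p : @ncpoly R) : R[i] :=
  \sum_(w <- msupp p) p@_w *: (word_value l w : R[i]^o).

Section Operators.
Context {H : hilbertType R}.
Variables A B : H -> H.

Lemma ncpoly_evalD p q x :
  ncpoly_eval (p + q) A B x = ncpoly_eval p A B x + ncpoly_eval q A B x.
Proof. exact: (ncpoly_linD (fun w : {fmonom bool} => word_eval A B w x)). Qed.

Lemma ncpoly_evalU c (w : {fmonom bool}) x :
  ncpoly_eval << c *g w >> A B x = c *: word_eval A B w x.
Proof. exact: (ncpoly_linU (fun w : {fmonom bool} => word_eval A B w x)). Qed.

Lemma ncpoly_valueD l p q : ncpoly_value l (p + q) = ncpoly_value l p + ncpoly_value l q.
Proof. exact: (ncpoly_linD (fun w : {fmonom bool} => word_value l w : R[i]^o)). Qed.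

Lemma ncpoly_valueU l c (w : {fmonom bool}) :
  ncpoly_value l << c *g w >> = c * word_value l w.
Proof. exact: (ncpoly_linU (fun w : {fmonom bool} => word_value l w : R[i]^o)). Qed.

Hypothesis hA : linear_bounded A.
Hypothesis hB : linear_bounded B.

Lemma linear_bounded_word w : linear_bounded (word_eval A B w).
Proof.
elim: w => [|b w IH]; first exact: linear_bounded_id.
by case: b; exact: linear_bounded_comp.
Qed.

Lemma linear_bounded_ncpoly p : linear_bounded (ncpoly_eval p A B).
Proof.
suff h (s : seq {fmonom bool}) : 
    linear_bounded (fun x => \sum_(w <- s) p@_w *: word_eval A B w x) by exact: h.
elim: s => [|w s IH].
  under eq_fun do rewrite big_nil; exact: linear_bounded_zero.
under eq_fun do rewrite big_cons.
apply: linear_bounded_add => //; apply: linear_bounded_scale.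
exact: linear_bounded_word.
Qed.

(** An almost joint eigenvector of [A] and [B] is one of every polynomial in
    them, with a Lipschitz constant depending on the polynomial only. *)
Lemma word_eval_approx l w : exists2 k : R, 0 <= k & forall x,
  rnorm (word_eval A B w x - word_value l w *: x) <=
  k * (rnorm (A x - l *: x) + rnorm (B x - l^* *: x)).
Proof.
elim: w => [|b w [k k0 IH]].
  by exists 0 => // x; rewrite mul0r scale1r subrr rnorm0.
set C := if b then B else A; set m := if b then l^* else l.
have [_ [M M0 hM]] : linear_bounded C by rewrite /C; case: b {C m}.
exists (M * k + rnorm (word_value l w)) => [|x].
  by rewrite addr_ge0 ?mulr_ge0 ?rnorm_ge0.
set s := rnorm (A x - _) + _.
have hs : rnorm (C x - m *: x) <= s.
  by rewrite /C /m /s; case: b {C m hM}; rewrite ?lerDl ?lerDr rnorm_ge0.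
have -> : word_eval A B (b :: w) x - word_value l (b :: w) *: x =
    C (word_eval A B w x - word_value l w *: x) + word_value l w *: (C x - m *: x).
  have hC : linear_bounded C by rewrite /C; case: b {C m hM hs}.
  rewrite (linear_boundedB hC) (linear_boundedZ hC) scalerBr addrA subrK scalerA.
  by rewrite (mulrC (word_value l w)) /C /m /=; case: b {C m hM hs hC}.
apply: le_trans (rnormD _ _) _; rewrite mulrDl; apply: lerD.
  by apply: le_trans (hM _) _; rewrite -mulrA ler_wpM2l.
by rewrite rnormZ ler_wpM2l ?rnorm_ge0.
Qed.

Lemma ncpoly_eval_approx l p : exists2 k : R, 0 <= k & forall x,
  rnorm (ncpoly_eval p A B x - ncpoly_value l p *: x) <=
  k * (rnorm (A x - l *: x) + rnorm (B x - l^* *: x)).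
Proof.
rewrite /ncpoly_eval /ncpoly_value; elim: (enum_fset (msupp p)) => [|w s [k k0 IH]].
  by exists 0 => // x; rewrite !big_nil scale0r subrr rnorm0 mul0r.
have [k' k'0 hw] := word_eval_approx l w.
exists (rnorm p@_w * k' + k) => [|x]; first by rewrite addr_ge0 ?mulr_ge0 ?rnorm_ge0.
rewrite !big_cons scalerDl opprD addrACA mulrDl.
apply: le_trans (rnormD _ _) (lerD _ (IH x)).
rewrite -[p@_w *: (_ : R[i]^o)]/(p@_w * word_value l w).
by rewrite -scalerA -scalerBr rnormZ -mulrA ler_wpM2l ?rnorm_ge0.
Qed.

End Operators.
End PolyEval.

Section OperatorNorm.
Context {R : realType} {H : hilbertType R}.
Implicit Types (A : H -> H) (x : H).

Lemma opnorm_le A (M : R) : 0 <= M -> (forall x, rnorm (A x) <= M * rnorm x) ->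
  (opnorm A <= M%:E)%E.
Proof.
move=> M0 hM; apply: ge_ereal_sup => _ [x /= x1 <-]; rewrite lee_fin.
apply: le_trans (hM x) _; rewrite -[leRHS]mulr1 ler_wpM2l //.
by rewrite -lecR rnormE.
Qed.

Lemma opnorm_ge A x : rnorm x <= 1 -> ((rnorm (A x))%:E <= opnorm A)%E.
Proof.
move=> x1; apply: ereal_sup_ubound; exists x => //=.
by rewrite -rnormE -lecR in x1 *.
Qed.

Lemma opnormP A : linear_bounded A -> exists m : R,
  [/\ 0 <= m, opnorm A = m%:E & forall x, rnorm (A x) <= m * rnorm x].
Proof.
move=> hA; have [_ [M M0 hM]] := hA.
have h0 : (0 <= opnorm A)%E.
  by apply: le_trans (opnorm_ge (x := 0) A _); rewrite ?rnorm0 ?lee_fin ?rnorm_ge0.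
have : opnorm A \is a fin_num.
  rewrite ge0_fin_numE //; apply: le_lt_trans (opnorm_le M0 hM) _; exact: ltry.
case E : (opnorm A) h0 => [m| |] // m0 _; exists m; split=> // x.
have [->|/rnorm_gt0 x0] := eqVneq x 0.
  by rewrite linear_bounded0 // !rnorm0 mulr0.
have := opnorm_ge (x := (rnorm x)^-1%:C%C *: x) A.
rewrite linear_boundedZ // !rnormZ rnorm_real ger0_norm ?invr_ge0 ?rnorm_ge0 //.
rewrite mulVf ?gt_eqF // => /(_ (lexx _)).
by rewrite E lee_fin mulrC ler_pdivrMr.
Qed.

Lemma opnorm_approx A (m a : R) : opnorm A = m%:E -> 0 <= a < m ->
  exists x, a * rnorm x < rnorm (A x).
Proof.
move=> E /andP[a0 am].
have : (a%:E < opnorm A)%E by rewrite E lte_fin.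
case/ereal_sup_gt => _ [x /= x1 <-]; rewrite lte_fin -/(rnorm _) => h.
exists x; apply: le_lt_trans h; rewrite -[leRHS]mulr1 ler_wpM2l //.
by rewrite -lecR rnormE.
Qed.

End OperatorNorm.

(** * Joint approximate eigenvalues *)

Section JointApprox.
Context {R : realType} {H : hilbertType R}.
Implicit Types (A : H -> H) (x y : H) (l : R[i]).

(** The characters of the C*-algebra generated by [A] are the evaluations at
    these points. *)
Definition joint_approx_eigenvalue A l := forall e : R, 0 < e -> exists x,
  rnorm (A x - l *: x) < e * rnorm x /\ rnorm (adjoint A x - l^* *: x) < e * rnorm x.

Lemma rnorm_gt0_of_lt (V : normedZmodType R[i]) (v : V) (r e : R) :
  0 <= r -> r < e * rnorm v -> 0 < rnorm v.
Proof.
move=> r0 h; rewrite lt_def rnorm_ge0 andbT; apply: contraTneq h => ->.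
by rewrite mulr0 -leNgt.
Qed.

(** On an almost joint eigenvector the polynomial acts almost as the scalar
    [ncpoly_value l p]. *)
Lemma joint_approx_value_le A l p : linear_bounded A -> joint_approx_eigenvalue A l ->
  ((rnorm (ncpoly_value l p))%:E <= opnorm (ncpoly_eval p A (adjoint A)))%E.
Proof.
move=> hA hl; have hA' := linear_bounded_adjoint hA.
have [m [m0 -> hm]] := opnormP (linear_bounded_ncpoly hA hA' p).
have [k k0 hk] := ncpoly_eval_approx hA hA' l p.
rewrite lee_fin; apply/ler_addgt0Pr => e e0.
have k1 : 0 < 2 * k + 1 by rewrite ltr_wpDl // mulr_ge0.
have [x [h1 h2]] := hl (e / (2 * k + 1)) (divr_gt0 e0 k1).
have x0 := rnorm_gt0_of_lt (rnorm_ge0 _) h1.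
rewrite -(ler_pM2r x0) -rnormZ.
set v := ncpoly_value l p; set y := ncpoly_eval p A (adjoint A) x.
have -> : v *: x = y - (y - v *: x) by rewrite subKr.
apply: le_trans (rnormD _ _) _; rewrite rnormN mulrDl; apply: lerD; first exact: hm.
apply: le_trans (hk x) _.
set d := e / _ in h1 h2.
have ed : e = d * (2 * k + 1) by rewrite /d divfK // gt_eqF.
have d0 : 0 < d by rewrite divr_gt0.
rewrite ed; nra.
Qed.

Section Separating.
Variables (A : H -> H) (l : R[i]).
Hypothesis hA : linear_bounded A.

Let B x := A x - l *: x.
Let B' x := adjoint A x - l^* *: x.
Let Q x := B' (B x) + B (B' x).

Let hB : linear_bounded B. Proof. exact: linear_bounded_shift. Qed.
Let hB' : linear_bounded B'.
Proof. by apply: linear_bounded_shift; exact: linear_bounded_adjoint. Qed.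

Lemma inner_shift x y : inner (A x - l *: x) y = inner x (adjoint A y - l^* *: y).
Proof. by rewrite innerBl innerBr innerZl innerZr conjCK adjointP. Qed.

Lemma inner_shift_adj x y : inner (adjoint A x - l^* *: x) y = inner x (A y - l *: y).
Proof. by rewrite innerC -inner_shift -innerC. Qed.

Let Q_ge x : rinner (Q x) x = rnorm (B x) ^+ 2 + rnorm (B' x) ^+ 2.
Proof.
rewrite /Q rinnerDl -!rinnerxx /rinner.
by rewrite (inner_shift_adj (B x) x) (inner_shift (B' x) x).
Qed.

Let mon (s : seq bool) : {fmonom bool} := FMonom s.

(** The operator [M - Q] expanded in monomials. *)
Let sep_poly (M : R[i]) : @ncpoly R :=
  << (M - 2 * (l * l^*)) *g mon [::] >> +
  (<< -1 *g mon [:: true; false] >> + (<< -1 *g mon [:: false; true] >> +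
  (<< 2 * l *g mon [:: true] >> + << 2 * l^* *g mon [:: false] >>))).

Let sep_value M : ncpoly_value l (sep_poly M) = M.
Proof. by rewrite /sep_poly !ncpoly_valueD !ncpoly_valueU /word_value /=; ring. Qed.

Let sep_eval M x : ncpoly_eval (sep_poly M) A (adjoint A) x = M *: x - Q x.
Proof.
rewrite /sep_poly !ncpoly_evalD !ncpoly_evalU /word_eval /=.
have hA' := linear_bounded_adjoint hA.
rewrite /Q /B /B' !(linear_boundedB hA) !(linear_boundedB hA').
rewrite !(linear_boundedZ hA) !(linear_boundedZ hA').
by apply: inner_ext => z; rewrite !(innerDl, innerBl, innerNl, innerZl); ring.
Qed.

(** If [l] is not a joint approximate eigenvalue then the positive operator
    [Q] is bounded below by some [c > 0], so for large [M] the polynomial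
    [M - Q] has norm less than [M] at [A] but value [M] at [l]. *)
Lemma joint_approx_of_value_le :
  (forall p, ((rnorm (ncpoly_value l p))%:E <= opnorm (ncpoly_eval p A (adjoint A)))%E) ->
  joint_approx_eigenvalue A l.
Proof.
move=> hp; have [//|/existsNP[e /not_implyP[e0 he]]] := pselect (joint_approx_eigenvalue A l).
have Q_coercive x : e ^+ 2 * rnorm x ^+ 2 <= rinner (Q x) x.
  rewrite Q_ge -exprMn.
  have [h|h] := ltP (rnorm (B x)) (e * rnorm x); last first.
    apply: ler_wpDr; first exact: sqr_ge0.
    by rewrite ler_pXn2r ?nnegrE ?mulr_ge0 ?rnorm_ge0 // ltW.
  have [h'|h'] := ltP (rnorm (B' x)) (e * rnorm x).
    by case: he; exists x.
  apply: ler_wpDl; first exact: sqr_ge0.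
  by rewrite ler_pXn2r ?nnegrE ?mulr_ge0 ?rnorm_ge0 // ltW.
have hQ : linear_bounded Q.
  by apply: linear_bounded_add; exact: linear_bounded_comp.
have [_ [L L0 hL]] := hQ.
have c0 : 0 < e ^+ 2 by rewrite exprn_gt0.
set c := e ^+ 2 in Q_coercive c0.
(* with this [M], the square of the norm of [M - Q] is at most
   [M ^ 2 - 2 M c + L ^ 2 <= M ^ 2 - 1] *)
set M := (L ^+ 2 + 1) / c + 1.
have M1 : 1 <= M by rewrite lerDr divr_ge0 ?(ltW c0) // addr_ge0 ?sqr_ge0.
have M0 : 0 <= M by apply: le_trans M1.
have Mc : L ^+ 2 + 1 <= M * c.
  by rewrite /M mulrDl divfK ?gt_eqF // mul1r lerDl ltW.
have hM x : rnorm (ncpoly_eval (sep_poly M%:C%C) A (adjoint A) x) ^+ 2 <=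
    (M ^+ 2 - 1) * rnorm x ^+ 2.
  rewrite sep_eval rnormB_sqr rnormZ rnorm_real (ger0_norm M0) rinnerZl rinnerC.
  have h1 := Q_coercive x.
  have h2 : rnorm (Q x) ^+ 2 <= L ^+ 2 * rnorm x ^+ 2.
    by rewrite -exprMn ler_pXn2r ?nnegrE ?mulr_ge0 ?rnorm_ge0.
  have h3 := ler_wpM2l M0 h1; have h4 := ler_wpM2r (sqr_ge0 (rnorm x)) Mc.
  have h5 := sqr_ge0 (L * rnorm x); have h6 := sqr_ge0 (rnorm x).
  rewrite exprMn; rewrite exprMn in h5.
  by move: h2 h3 h4 h5 h6; set n := rnorm x ^+ 2; nra.
have [m [m0 Em _]] := opnormP (linear_bounded_ncpoly hA (linear_bounded_adjoint hA)
  (sep_poly M%:C%C)).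
have := hp (sep_poly M%:C%C); rewrite sep_value Em lee_fin rnorm_real ger0_norm // => Mm.
have M2 : 0 <= M ^+ 2 - 1 by rewrite subr_ge0 expr_ge1.
have [|x] := @opnorm_approx _ _ _ _ (Num.sqrt (M ^+ 2 - 1)) Em.
  rewrite sqrtr_ge0 /=; apply: lt_le_trans Mm.
  by rewrite -(@ltr_pXn2r _ 2) ?nnegrE ?sqrtr_ge0 // sqr_sqrtr // gtrBl.
rewrite -(@ltr_pXn2r _ 2) ?nnegrE ?mulr_ge0 ?sqrtr_ge0 ?rnorm_ge0 //.
by rewrite exprMn sqr_sqrtr // ltNge hM.
Qed.

End Separating.
End JointApprox.

(** * Normal operators: spectrum and joint approximate eigenvalues *)

Section BoundedOperatorOf.
Context {R : realType} {H : hilbertType R}.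
Variables (S : H -> H) (hS : linear_bounded S).

(** A copy of [S] that can carry a canonical linear structure. *)
Definition linear_bounded_fun of linear_bounded S := S.

HB.instance Definition _ := GRing.isLinear.Build R[i] H H *:%R
  (linear_bounded_fun hS) (proj1 hS).

Lemma linear_bounded_operator :
  exists A : bounded_operator H, forall x, A x = S x.
Proof.
have [M M0 hM] := proj2 hS.
have hb : exists M : R[i], forall x, `|linear_bounded_fun hS x| <= M * `|x|.
  by exists M%:C%C => x; rewrite -!rnormE -rmorphM /= lecR.
by exists (@BoundedOperator R H (linear_bounded_fun hS) hb).
Qed.

End BoundedOperatorOf.

Section NormalSpectrum.
Context {R : realType} {H : hilbertType R}.
Variable N : H -> H.
Hypothesis hN : linear_bounded N.
Hypothesis Nnormal : forall x, N (adjoint N x) = adjoint N (N x).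

Lemma normal_rnorm_shift l x :
  rnorm (adjoint N x - l^* *: x) = rnorm (N x - l *: x).
Proof.
have hN' := linear_bounded_adjoint hN.
apply/eqP; rewrite -(@eqrXn2 _ 2) ?rnorm_ge0 // -!rinnerxx /rinner; apply/eqP.
rewrite inner_shift_adj // [in RHS]inner_shift //; congr (complex.Re (inner _ _)).
rewrite !(linear_boundedB hN) !(linear_boundedB hN').
rewrite !(linear_boundedZ hN) !(linear_boundedZ hN') Nnormal.
by apply: inner_ext => z; rewrite !(innerDl, innerBl, innerNl, innerZl); ring.
Qed.

(** By normality [N - l] and its adjoint have equal norms on each vector. *)
Lemma joint_approx_normalP l : joint_approx_eigenvalue N l <->
  forall e : R, 0 < e -> exists x, rnorm (N x - l *: x) < e * rnorm x.
Proof.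
split=> h e /h[x hx]; exists x; first by case: hx.
by rewrite normal_rnorm_shift.
Qed.

(** [N - l] and its adjoint are bounded below together, and then the normal
    equation [(N - l)^* (N - l) z = (N - l)^* y] is solvable by Lax-Milgram. *)
Lemma normal_shift_invertible l (e : R) : 0 < e ->
  (forall x, e * rnorm x <= rnorm (N x - l *: x)) ->
  exists2 S, linear_bounded S &
    (forall x, S (N x - l *: x) = x) /\ (forall x, N (S x) - l *: S x = x).
Proof.
move=> e0 he.
pose B x := N x - l *: x; pose B' x := adjoint N x - l^* *: x.
have hB : linear_bounded B by exact: linear_bounded_shift.
have hB' : linear_bounded B' by apply: linear_bounded_shift; exact: linear_bounded_adjoint.
have BB' x y : inner (B x) y = inner x (B' y) by exact: inner_shift.
have B'B x y : inner (B' x) y = inner x (B y) by exact: inner_shift_adj.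
have Binj x y : B x = B y -> x = y.
  move=> xy; apply/subr0_eq/rnorm_eq0/eqP; rewrite eq_le rnorm_ge0 andbT.
  rewrite -(pmulr_rle0 _ e0); apply: le_trans (he _) _.
  by rewrite -/(B (x - y)) linear_boundedB // xy subrr rnorm0.
have /choice[S hS] : forall y, exists z, B z = y.
  move=> y.
  have [||||||z hz] := @lax_milgram R H (fun x => B' (B x)) (e ^+ 2)
      (fun x => inner x (B' y)) (rnorm (B' y)).
  - exact: linear_bounded_comp.
  - by move=> u v; rewrite B'B BB'.
  - by rewrite exprn_gt0.
  - move=> x; rewrite /rinner B'B -/(rinner _ _) rinnerxx -exprMn.
    by rewrite ler_pXn2r ?nnegrE ?mulr_ge0 ?rnorm_ge0 // ltW.
  - by move=> a u v; rewrite innerDl innerZl.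
  - by move=> x; rewrite mulrC; exact: cauchy_schwarz.
  exists z; apply/subr0_eq/rnorm_eq0/eqP; rewrite eq_le rnorm_ge0 andbT.
  rewrite -(pmulr_rle0 _ e0); apply: le_trans (he _) _.
  rewrite -normal_rnorm_shift -/(B' _) linear_boundedB //.
  suff -> : B' (B z) = B' y by rewrite subrr rnorm0.
  by apply: inner_extr => x; rewrite hz B'B BB'.
exists S; last by split=> x; [apply: Binj; rewrite hS | exact: hS].
split=> [a x y|].
  by apply: Binj; rewrite (linear_boundedD hB) (linear_boundedZ hB) !hS.
exists e^-1 => [|x]; first by rewrite invr_ge0 ltW.
by rewrite mulrC ler_pdivlMr // mulrC -{2}(hS x) he.
Qed.

End NormalSpectrum.

(** A normal operator has no residual spectrum: failure of invertibility always
    comes from approximate eigenvectors. *)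
Lemma spectrum_normalP (R : realType) (H : hilbertType R) (N : bounded_operator H) l :
  normal_operator N -> spectrum N l <-> joint_approx_eigenvalue N l.
Proof.
move=> Nnormal; have hN := bounded_operatorP N.
rewrite joint_approx_normalP //; split=> [hl|hl [S [hS _]]].
  apply: contrapT => /existsNP[e /not_implyP[e0 /forallNP he]]; apply: hl.
  have [x|S hS [S1 S2]] := normal_shift_invertible hN Nnormal (l := l) e0.
    by rewrite leNgt; apply/negP.
  have [A hA] := linear_bounded_operator hS.
  by exists A; split=> x; rewrite !hA.
have [_ [M M0 hM]] := bounded_operatorP S.
have M1 : 0 < M + 1 by rewrite ltr_wpDl.
have [x hx] := hl (M + 1)^-1 ltac:(by rewrite invr_gt0).
have x0 := rnorm_gt0_of_lt (rnorm_ge0 _) hx.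
have := hM (N x - l *: x); rewrite hS => h.
have : rnorm x <= M * ((M + 1)^-1 * rnorm x).
  by apply: le_trans h _; rewrite ler_wpM2l // ltW.
by rewrite mulrA ler_pMl // ler_pdivlMr // mul1r leNgt ltrDl ltr01.
Qed.

(** * Approximate kernels and the power method *)

Section PowerMethod.
Context {R : realType} {H : hilbertType R}.
Variables (S : H -> H) (M : R).
Hypothesis hS : linear_bounded S.
Hypothesis Ssym : forall x y, inner (S x) y = inner x (S y).
Hypothesis S_ge1 : forall x, rnorm x ^+ 2 <= rinner (S x) x.
Hypothesis M_ge1 : 1 <= M.
Hypothesis S_leM : forall x, rnorm (S x) <= M * rnorm x.
Implicit Types x y : H.

Lemma rnorm_le_self x : rnorm x <= rnorm (S x).
Proof.
have [->|/rnorm_gt0 x0] := eqVneq x 0; first by rewrite rnorm0 rnorm_ge0.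
by rewrite -(ler_pM2r x0) -expr2; apply: le_trans (S_ge1 x) (rinner_le _ _).
Qed.

Lemma rnorm_iter_le k x : rnorm (iter k S x) <= M ^+ k * rnorm x.
Proof.
elim: k => [|k IH]; first by rewrite mul1r.
rewrite iterS exprS -mulrA; apply: le_trans (S_leM _) _.
by rewrite ler_wpM2l // (le_trans ler01).
Qed.

Lemma rnorm_iter_ge k x : rnorm x <= rnorm (iter k S x).
Proof. by elim: k => // k IH; apply: le_trans IH (rnorm_le_self _). Qed.

(** One step of the method: if the growth rate of the iterates hardly changes
    from [y] to [S y], then [y] is almost an eigenvector of [S ^ 2], hence of
    the positive operator [S]. *)
Lemma power_step y (r r' : R) : 1 <= r -> r <= r' -> r' <= M ->
  rnorm (S y) = r * rnorm y -> rnorm (S (S y)) = r' * rnorm (S y) -> 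
  rnorm (S y - r%:C%C *: y) ^+ 2 <= 2 * M ^+ 3 * (r' - r) * rnorm y ^+ 2.
Proof.
move=> r1 rr' r'M hr hr'.
set z := S y - _.
have hz : S z + r%:C%C *: z = S (S y) - (r ^+ 2)%:C%C *: y.
  rewrite /z (linear_boundedB hS) (linear_boundedZ hS) scalerBr scalerA -rmorphM /= -expr2.
  by rewrite addrA subrK.
have h1 : rnorm z ^+ 2 <= rnorm (S z + r%:C%C *: z) ^+ 2.
  rewrite rnormD_sqr rinnerZr rnormZ rnorm_real ger0_norm ?(le_trans ler01) //.
  have := S_ge1 z; have := sqr_ge0 (rnorm z); have := sqr_ge0 (rnorm (S z)).
  rewrite exprMn; set a := rnorm z ^+ 2; set b := rnorm _ ^+ 2; set q := rinner _ _.
  by nra.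
apply: le_trans h1 _; rewrite hz rnormB_sqr rinnerZr rnormZ rnorm_real.
have -> : rinner (S (S y)) y = rnorm (S y) ^+ 2 by rewrite -rinnerxx /rinner Ssym.
rewrite ger0_norm ?sqr_ge0 // hr' hr !exprMn.
have := sqr_ge0 (rnorm y); set n := rnorm y ^+ 2 => n0.
have M0 : 0 <= M by apply: le_trans M_ge1.
have r0 : 0 <= r by apply: le_trans r1.
have h2 : r ^+ 2 <= M ^+ 2.
  by rewrite ler_pXn2r ?nnegrE // (le_trans rr').
have h3 : (r' - r) * (r' + r) <= (r' - r) * (2 * M).
  by rewrite ler_wpM2l ?subr_ge0 //; lra.
have h4 : r ^+ 2 * ((r' - r) * (r' + r)) <= M ^+ 2 * ((r' - r) * (2 * M)).
  by apply: ler_pM => //; rewrite ?sqr_ge0 // mulr_ge0 ?subr_ge0 ?addr_ge0 // (le_trans r0).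
have := ler_wpM2r n0 h4; rewrite [X in _ <= X -> _](_ : _ = 2 * M ^+ 3 * (r' - r) * n); last by ring.
apply: le_trans; rewrite le_eqVlt; apply/orP; left; apply/eqP; ring.
Qed.

Let ratio x k := rnorm (iter k.+1 S x) / rnorm (iter k S x).

Let iter_gt0 x k : x != 0 -> 0 < rnorm (iter k S x).
Proof. by move=> /rnorm_gt0 x0; apply: lt_le_trans x0 (rnorm_iter_ge k x). Qed.

Let ratioE x k : x != 0 -> rnorm (S (iter k S x)) = ratio x k * rnorm (iter k S x).
Proof. by move=> x0; rewrite /ratio divfK // gt_eqF // iter_gt0. Qed.

Let ratio_ge1 x k : x != 0 -> 1 <= ratio x k.
Proof. by move=> x0; rewrite ler_pdivlMr ?iter_gt0 // mul1r rnorm_le_self. Qed.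

Let ratio_leM x k : x != 0 -> ratio x k <= M.
Proof. by move=> x0; rewrite ler_pdivrMr ?iter_gt0 //; exact: S_leM. Qed.

(** Symmetry makes the norms of the iterates log-convex. *)
Let ratio_nd x k : x != 0 -> ratio x k <= ratio x k.+1.
Proof.
move=> x0; rewrite ler_pdivrMr ?iter_gt0 // mulrAC ler_pdivlMr ?iter_gt0 //.
rewrite -expr2 -rinnerxx /rinner [X in inner _ X]iterS -Ssym.
exact: rinner_le.
Qed.

(** Bounded nondecreasing growth rates must stall within a number of steps
    that does not depend on the starting vector. *)
Lemma power_method (e : R) : 0 < e -> exists n : nat, forall x, x != 0 ->
  exists k r, [/\ (k <= n)%N, 1 <= r <= M &
    rnorm (S (iter k S x) - r%:C%C *: iter k S x) <= e * rnorm (iter k S x)].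
Proof.
move=> e0; have M0 : 0 < M by apply: lt_le_trans M_ge1.
(* a gap of at most [d] between consecutive growth rates gives the error [e]
   in [power_step] *)
pose d := e ^+ 2 / (2 * M ^+ 3).
have M3 : 0 < 2 * M ^+ 3 by rewrite mulr_gt0 // exprn_gt0.
have d0 : 0 < d by rewrite divr_gt0 // exprn_gt0.
have [n hn] : exists n : nat, M < d * n%:R.
  exists (Num.trunc (M / d)).+1; rewrite mulrC -ltr_pdivrMr //.
  exact: truncnS_gt.
exists n => x x0.
have [k kn hk] : exists2 k, (k <= n)%N & ratio x k.+1 - ratio x k <= d.
  apply: contrapT => /forall2NP h.
  have : forall j, (j <= n)%N -> d * j%:R <= ratio x j - ratio x 0%N.
    elim=> [|j IH] jn; first by rewrite mulr0 subrr.
    have [//|/negP] := h j; first by rewrite ltnW.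
    rewrite -ltNge => hj; have := IH (ltnW jn).
    by rewrite -natr1 mulrDr mulr1; lra.
  move=> /(_ n (leqnn n)); have := ratio_leM n x0; have := ratio_ge1 0 x0.
  by move: hn; lra.
exists k, (ratio x k); split=> //; first by rewrite ratio_ge1 ?ratio_leM.
rewrite -(@ler_pXn2r _ 2) ?nnegrE ?mulr_ge0 ?rnorm_ge0 ?(ltW e0) //.
apply: le_trans (@power_step _ _ (ratio x k.+1) _ _ _ _ _) _.
- exact: ratio_ge1.
- exact: ratio_nd.
- exact: ratio_leM.
- exact: ratioE.
- exact: (ratioE k.+1).
rewrite exprMn ler_wpM2r ?sqr_ge0 //.
by rewrite mulrC -ler_pdivlMr.
Qed.

End PowerMethod.

(** * Norms of polynomials in a normal operator *)

Section Extension.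
Context {R : realType} {H : hilbertType R}.
Implicit Types x y : H.

Definition approx_kernel (Cs : set (H -> H)) := forall e : R, 0 < e ->
  exists2 x : H, x != 0 & forall C, Cs C -> rnorm (C x) <= e * rnorm x.

(** The point is the superior limit, as [e] tends to [0], of the sets [P e]. *)
Lemma approx_cluster (P : R -> R -> Prop) (a b : R) :
  (forall e e' r, e <= e' -> P e r -> P e' r) ->
  (forall e, 0 < e -> exists2 r, a <= r <= b & P e r) ->
  exists r, forall e, 0 < e -> exists2 r', `|r' - r| <= e & P e r'.
Proof.
move=> mono hP.
pose E := [set t | forall e, 0 < e -> exists2 r, t <= r <= b & P e r].
have Esup : has_sup E.
  by split; [exists a | exists b => t /(_ 1 ltr01)[r /andP[/le_trans h /h]]].
exists (sup E) => e e0.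
have [t Et supt] := sup_adherent e0 Esup.
have : ~ E (sup E + e).
  by move=> /(ub_le_sup (proj2 Esup)); rewrite leNgt ltrDl e0.
move=> /existsNP[d /not_implyP[d0 hd]].
have [|r /andP[tr rb] Pr] := Et (Num.min d e); first by rewrite lt_min d0 e0.
exists r; last by apply: mono Pr; rewrite ge_min lexx orbT.
rewrite ler_norml; apply/andP; split; first by lra.
rewrite lerBlDl leNgt; apply/negP => h; apply: hd; exists r.
  by rewrite (ltW h) rb.
by apply: mono Pr; rewrite ge_min lexx.
Qed.

Variable A : H -> H.
Hypothesis hA : linear_bounded A.
Hypothesis Asym : forall x y, inner (A x) y = inner x (A y).

(** A symmetric operator has an approximate eigenvector inside every
    approximate kernel that it leaves invariant: shift it to be at least [1]
    and iterate it on a good enough element of the approximate kernel. *)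
Lemma approx_kernel_extend (Cs : set (H -> H)) :
  (forall C, Cs C -> forall x, C (A x) = A (C x)) ->
  (forall C, Cs C -> linear_bounded C) ->
  approx_kernel Cs ->
  exists r : R, approx_kernel (Cs `|` [set fun x => A x - r%:C%C *: x]).
Proof.
move=> comm Cslin hCs.
have [_ [L L0 hL]] := hA.
pose S x := A x + (L + 1)%:C%C *: x.
have hS : linear_bounded S.
  by apply: linear_bounded_add => //; apply: linear_bounded_scale; exact: linear_bounded_id.
have L1 : 0 <= L + 1 by rewrite addr_ge0.
have Ssym x y : inner (S x) y = inner x (S y).
  by rewrite /S innerDl innerDr innerZl innerZr conj_real Asym.
have S_ge1 x : rnorm x ^+ 2 <= rinner (S x) x.
  rewrite /S rinnerDl rinnerZl rinnerxx.
  have : - rinner (A x) x <= L * rnorm x ^+ 2.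
    rewrite -rinnerNl expr2 mulrA; apply: le_trans (rinner_le _ _) _.
    by rewrite rnormN ler_wpM2r ?rnorm_ge0.
  by lra.
pose M := L + L + 1.
have M1 : 1 <= M by rewrite lerDr addr_ge0.
have SM x : rnorm (S x) <= M * rnorm x.
  apply: le_trans (rnormD _ _) _; rewrite rnormZ rnorm_real ger0_norm //.
  by rewrite /M -addrA [leRHS]mulrDl lerD2r.
pose P e r := exists2 x : H, x != 0 &
  (forall C, Cs C -> rnorm (C x) <= e * rnorm x) /\
  rnorm (S x - r%:C%C *: x) <= e * rnorm x.
have mono e e' r : e <= e' -> P e r -> P e' r.
  move=> ee' [x x0 [h1 h2]]; exists x => //; split=> [C CsC|].
    by apply: le_trans (h1 C CsC) _; rewrite ler_wpM2r ?rnorm_ge0.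
  by apply: le_trans h2 _; rewrite ler_wpM2r ?rnorm_ge0.
have hP e : 0 < e -> exists2 r, 1 <= r <= M & P e r.
  move=> e0; have [n hn] := power_method hS Ssym S_ge1 M1 SM e0.
  have Mn : 0 < M ^+ n by rewrite exprn_gt0 // (lt_le_trans ltr01).
  (* at most [n] applications of [S] amplify errors by at most [M ^ n] *)
  have [x x0 hx] := hCs (e / M ^+ n) (divr_gt0 e0 Mn).
  have [k [r [kn rM hk]]] := hn x x0.
  have xk := rnorm_iter_ge S_ge1 k x.
  exists r => //; exists (iter k S x).
    by apply: contraTneq (rnorm_gt0 x0) => xk0; rewrite -leNgt (le_trans xk) // xk0 rnorm0.
  split=> // C CsC.
  have -> : C (iter k S x) = iter k S (C x).
    elim: k {kn hk xk} => // k IH; rewrite !iterS -IH /S.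
    by rewrite (linear_boundedD (Cslin _ CsC)) (linear_boundedZ (Cslin _ CsC)) comm.
  apply: le_trans (rnorm_iter_le M1 SM k (C x)) _.
  have {}hx := hx C CsC.
  apply: le_trans (ler_wpM2l (ltW e0) xk).
  have h : M ^+ k <= M ^+ n by rewrite ler_weXn2l.
  apply: le_trans (ler_wpM2r (rnorm_ge0 _) h) _.
  by apply: le_trans (ler_wpM2l (ltW Mn) hx) _; rewrite mulrA mulrCA divff ?gt_eqF ?mulr1.
have [r hr] := approx_cluster mono hP.
exists (r - (L + 1)) => e e0.
have e2 : 0 < e / 2 by rewrite divr_gt0.
have [r' rr' [x x0 [h1 h2]]] := hr (e / 2) e2.
exists x => // C [CsC|->].
  by apply: le_trans (h1 C CsC) _; rewrite ler_wpM2r ?rnorm_ge0 // ler_pdivrMr // ler_pMr // ler1n.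
rewrite (_ : _ - _ = S x - r'%:C%C *: x + (r' - r)%:C%C *: x); last first.
  by apply: inner_ext => z; rewrite /S !(innerDl, innerBl, innerNl, innerZl); ring.
apply: le_trans (rnormD _ _) _; rewrite rnormZ rnorm_real.
have := ler_wpM2r (rnorm_ge0 x) rr'.
by move: h2; lra.
Qed.

End Extension.

Section NormalPolynomials.
Context {R : realType} {H : hilbertType R}.
Variable N : H -> H.
Hypothesis hN : linear_bounded N.
Hypothesis Nnormal : forall x, N (adjoint N x) = adjoint N (N x).
Implicit Types x y : H.

Let hN' := linear_bounded_adjoint hN.

Lemma word_eval_normal_comm w x :
  word_eval N (adjoint N) w (N x) = N (word_eval N (adjoint N) w x) /\
  word_eval N (adjoint N) w (adjoint N x) = adjoint N (word_eval N (adjoint N) w x).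
Proof.
by elim: w => // -[] w [IH1 IH2]; rewrite /= -/(word_eval N (adjoint N) w _) IH1 IH2 Nnormal.
Qed.

Let A p := ncpoly_eval p N (adjoint N).

Lemma ncpoly_eval_normal_comm p x :
  A p (N x) = N (A p x) /\ A p (adjoint N x) = adjoint N (A p x).
Proof.
rewrite /A /ncpoly_eval (linear_bounded_sum hN) (linear_bounded_sum hN').
split; apply: eq_bigr => w _.
  by rewrite (linear_boundedZ hN) (proj1 (word_eval_normal_comm _ _)).
by rewrite (linear_boundedZ hN') (proj2 (word_eval_normal_comm _ _)).
Qed.

Let hA p : linear_bounded (A p) := linear_bounded_ncpoly hN hN' p.

Lemma adjoint_ncpoly_normal_comm p x :
  adjoint (A p) (N x) = N (adjoint (A p) x) /\
  adjoint (A p) (adjoint N x) = adjoint N (adjoint (A p) x).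
Proof.
split; apply: inner_ext => y.
  rewrite (inner_adjointl (hA p)) (adjointP hN) (adjointP hN).
  by rewrite (inner_adjointl (hA p)) (proj2 (ncpoly_eval_normal_comm _ _)).
rewrite (inner_adjointl (hA p)) (inner_adjointl hN) (inner_adjointl hN).
by rewrite (inner_adjointl (hA p)) (proj1 (ncpoly_eval_normal_comm _ _)).
Qed.

(** With [A] the polynomial in question and [m] its norm, [A^* A - m ^ 2] has an
    approximate kernel; the real and imaginary parts of [N] commute with it and
    with each other, so they have approximate eigenvectors in common inside it. *)
Lemma normal_opnorm_attained p (v0 : H) : v0 != 0 ->
  exists2 l, joint_approx_eigenvalue N l &
    (opnorm (ncpoly_eval p N (adjoint N)) <= (rnorm (ncpoly_value l p))%:E)%E.
Proof.
move=> v00; have [m [m0 Em hm]] := opnormP (hA p).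
pose C0 x := adjoint (A p) (A p x) - (m ^+ 2)%:C%C *: x.
have hC0 : linear_bounded C0.
  apply: linear_bounded_shift; apply: linear_bounded_comp => //.
  exact: linear_bounded_adjoint.
have C0N x : C0 (N x) = N (C0 x).
  rewrite /C0 (linear_boundedB hN) (linear_boundedZ hN).
  by rewrite (proj1 (ncpoly_eval_normal_comm _ _)) (proj1 (adjoint_ncpoly_normal_comm _ _)).
have C0N' x : C0 (adjoint N x) = adjoint N (C0 x).
  rewrite /C0 (linear_boundedB hN') (linear_boundedZ hN').
  by rewrite (proj2 (ncpoly_eval_normal_comm _ _)) (proj2 (adjoint_ncpoly_normal_comm _ _)).
have ker0 : approx_kernel [set C0].
  move=> e e0.
  have sqr_bound x : rnorm (C0 x) ^+ 2 <= m ^+ 2 * (m ^+ 2 * rnorm x ^+ 2 - rnorm (A p x) ^+ 2).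
    rewrite /C0 rnormB_sqr rnormZ rnorm_real ger0_norm ?sqr_ge0 // rinnerZr.
    have -> : rinner (adjoint (A p) (A p x)) x = rnorm (A p x) ^+ 2.
      by rewrite /rinner (inner_adjointl (hA p)) innerxx.
    have h := adjoint_bound (hA p) m0 hm (A p x).
    have {}h : rnorm (adjoint (A p) (A p x)) ^+ 2 <= m ^+ 2 * rnorm (A p x) ^+ 2.
      by rewrite -exprMn ler_pXn2r ?nnegrE ?mulr_ge0 ?rnorm_ge0.
    rewrite exprMn; move: h; set a := rnorm (adjoint _ _) ^+ 2.
    by move=> h; rewrite -subr_ge0; move: h; rewrite -subr_ge0; congr (0 <= _); ring.
  (* hence a vector whose image has norm at least [a] times its own, with
     [a ^ 2] this close to [m ^ 2], lies almost in the kernel of [C0] *)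
  have bnd x (a : R) : 0 <= a -> a ^+ 2 >= m ^+ 2 - e ^+ 2 / (m ^+ 2 + 1) ->
      a * rnorm x <= rnorm (A p x) -> rnorm (C0 x) <= e * rnorm x.
    move=> a0 ha hx.
    rewrite -(@ler_pXn2r _ 2) ?nnegrE ?mulr_ge0 ?rnorm_ge0 ?(ltW e0) //.
    apply: le_trans (sqr_bound x) _; rewrite exprMn.
    have {}hx : a ^+ 2 * rnorm x ^+ 2 <= rnorm (A p x) ^+ 2.
      by rewrite -exprMn ler_pXn2r ?nnegrE ?mulr_ge0 ?rnorm_ge0.
    have m1 : 0 < m ^+ 2 + 1 by rewrite ltr_wpDl ?sqr_ge0.
    have m2 : m ^+ 2 <= m ^+ 2 + 1 by rewrite lerDl.
    set d := e ^+ 2 / _ in ha.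
    have -> : e ^+ 2 = (m ^+ 2 + 1) * d by rewrite /d mulrC divfK // gt_eqF.
    have d0 : 0 <= d by rewrite divr_ge0 ?sqr_ge0 // ltW.
    have n0 := sqr_ge0 (rnorm x).
    have h1 : m ^+ 2 * rnorm x ^+ 2 - rnorm (A p x) ^+ 2 <= d * rnorm x ^+ 2.
      by have := ler_wpM2r n0 ha; move: hx; lra.
    apply: le_trans (ler_wpM2l (sqr_ge0 m) h1) _.
    by rewrite -[leRHS]mulrA; apply: (ler_wpM2r (mulr_ge0 d0 n0)).
  have [m00|mpos] := eqVneq m 0.
    exists v0 => // C ->; apply: (bnd v0 0) => //; last by rewrite mul0r rnorm_ge0.
    by rewrite m00 expr0n /= !add0r divr1 oppr_le0 sqr_ge0.
  have {}mpos : 0 < m by rewrite lt_def mpos.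
  set t := m ^+ 2 - e ^+ 2 / (m ^+ 2 + 1).
  have tm : t < m ^+ 2.
    by rewrite gtrBl divr_gt0 ?exprn_gt0 // ltr_wpDl ?sqr_ge0.
  have [|x hx] := @opnorm_approx _ _ _ _ (Num.sqrt t) Em.
    rewrite sqrtr_ge0 /= -(@ltr_pXn2r _ 2) ?nnegrE ?sqrtr_ge0 //.
    have [t0|t0] := leP 0 t; first by rewrite sqr_sqrtr.
    by rewrite ltr0_sqrtr // expr0n /= exprn_gt0.
  exists x.
    by apply: contraTneq hx => ->; rewrite linear_bounded0 // !rnorm0 mulr0 ltxx.
  move=> C ->; apply: (bnd x (Num.sqrt t)); rewrite ?sqrtr_ge0 ?(ltW hx) //.
  have [t0|t0] := leP 0 t; first by rewrite sqr_sqrtr.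
  by rewrite ltr0_sqrtr // expr0n /= ltW.
(* twice the real part and twice the imaginary part of [N] *)
pose X x := N x + adjoint N x.
pose Y x := ('i%C : R[i]) *: (adjoint N x - N x).
have hX : linear_bounded X by exact: linear_bounded_add.
have hY : linear_bounded Y.
  have := linear_bounded_scale 'i%C (linear_bounded_add hN' (linear_bounded_scale (-1) hN)).
  by under eq_fun do rewrite scaleN1r.
have Xsym x y : inner (X x) y = inner x (X y).
  by rewrite innerDl innerDr (adjointP hN) (inner_adjointl hN) addrC.
have Ysym x y : inner (Y x) y = inner x (Y y).
  rewrite innerZl innerZr innerBl innerBr (adjointP hN) (inner_adjointl hN).
  have -> : ('i%C : R[i])^* = - 'i%C by apply/eqP; rewrite eq_complex /= oppr0 !eqxx.
  by ring.
have XY x : X (Y x) = Y (X x).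
  rewrite /X /Y (linear_boundedZ hN) (linear_boundedZ hN') -scalerDr.
  rewrite !(linear_boundedB hN) !(linear_boundedB hN') (linear_boundedD hN) (linear_boundedD hN').
  rewrite Nnormal; congr (_ *: _); apply: inner_ext => z.
  by rewrite !(innerDl, innerBl, innerNl); ring.
have C0X x : C0 (X x) = X (C0 x) by rewrite /X (linear_boundedD hC0) C0N C0N'.
have C0Y x : C0 (Y x) = Y (C0 x).
  by rewrite /Y (linear_boundedZ hC0) (linear_boundedB hC0) C0N C0N'.
have [||r ker1] := approx_kernel_extend hX Xsym _ _ ker0.
- by move=> C ->.
- by move=> C ->.
have [||s ker2] := approx_kernel_extend hY Ysym _ _ ker1.
- by move=> C [->//|->] x; rewrite XY (linear_boundedB hY) (linear_boundedZ hY).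
- by move=> C [->//|->]; exact: linear_bounded_shift.
pose l : R[i] := (2^-1)%:C%C * (r%:C%C + 'i%C * s%:C%C).
have hl e : 0 < e -> exists2 x : H, x != 0 &
    rnorm (C0 x) <= e * rnorm x /\ rnorm (N x - l *: x) <= e * rnorm x.
  move=> e0; have [x x0 hx] := ker2 e e0; exists x => //; split.
    by apply: hx; left; left.
  have h1 := hx _ (or_introl (or_intror erefl)); have h2 := hx _ (or_intror erefl).
  have -> : N x - l *: x = (2^-1)%:C%C *: ((X x - r%:C%C *: x) + 'i%C *: (Y x - s%:C%C *: x)).
    have i2 : ('i%C : R[i]) * 'i%C = -1 by rewrite -expr2 sqr_i.
    have h2' : (2^-1)%:C%C + (2^-1)%:C%C = 1 :> R[i].
      by rewrite -rmorphD /= -[2^-1]mul1r -splitr.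
    rewrite /X /Y /l; apply: inner_ext => z.
    rewrite !(innerDl, innerBl, innerNl, innerZl).
    move: (inner (N x) z) (inner (adjoint N x) z) (inner x z) => a b c.
    set h := (2^-1)%:C%C in h2' *; rewrite -{1}[a]mul1r -h2'.
    rewrite (_ : 'i%C * ('i%C * (b - a) - _) = ('i%C * 'i%C) * (b - a) - 'i%C * (s%:C%C * c)); last by ring.
    by rewrite i2; ring.
  rewrite rnormZ rnorm_real ger0_norm ?invr_ge0 // mulrC ler_pdivrMr //.
  apply: le_trans (rnormD _ _) _; rewrite rnormZ.
  have -> : rnorm ('i%C : R[i]) = 1 by rewrite /rnorm normc_def /= expr0n add0r expr1n sqrtr1.
  by rewrite mul1r; lra.
exists l.
  apply/joint_approx_normalP => // e e0.
  have [x x0 [_ hx]] := hl (e / 2) (divr_gt0 e0 (ltr0Sn _ _)); exists x.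
  apply: le_lt_trans hx _; rewrite ltr_pM2r ?rnorm_gt0 // ltr_pdivrMr // ltr_pMr // ltr1n.
  by [].
rewrite -/(A p) Em lee_fin.
set v := ncpoly_value l p.
have [k k0 hk] := ncpoly_eval_approx hN hN' l p.
rewrite -(@ler_pXn2r _ 2) ?nnegrE ?rnorm_ge0 //.
apply/ler_addgt0Pr => eps eps0.
set V := rnorm v.
have V0 : 0 <= V by exact: rnorm_ge0.
(* for [e <= 1] the squared error terms add up to at most [e * D] *)
pose D := 4 * k * V + 4 * k ^+ 2 + 1.
have D0 : 0 < D by rewrite /D ltr_wpDl // addr_ge0 ?mulr_ge0 ?sqr_ge0.
pose e := Num.min 1 (eps / D).
have e0 : 0 < e by rewrite lt_min ltr01 divr_gt0.
have e1 : e <= 1 by rewrite ge_min lexx.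
have eD : e * D <= eps by rewrite -ler_pdivlMr // ge_min lexx orbT.
have [x x0 [h1 h2]] := hl e e0.
have xpos := rnorm_gt0 x0.
have h3 : rnorm (A p x) <= (V + 2 * k * e) * rnorm x.
  rewrite -[A p x](subrK (v *: x)); apply: le_trans (rnormD _ _) _.
  rewrite rnormZ mulrDl addrC lerD2l; apply: le_trans (hk x) _.
  rewrite (normal_rnorm_shift hN Nnormal) -mulr2n -[_ *+ 2]mulr_natl mulrCA -!mulrA.
  by rewrite ler_wpM2l // ler_wpM2l.
have h4 : rnorm (A p x) ^+ 2 <= (V + 2 * k * e) ^+ 2 * rnorm x ^+ 2.
  rewrite -exprMn ler_pXn2r ?nnegrE ?rnorm_ge0 // mulr_ge0 ?rnorm_ge0 //.
  by rewrite addr_ge0 // !mulr_ge0 // ltW.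
have h5 : m ^+ 2 * rnorm x ^+ 2 - rnorm (A p x) ^+ 2 <= e * rnorm x ^+ 2.
  have : - rinner (C0 x) x <= e * rnorm x ^+ 2.
    rewrite -rinnerNl expr2 mulrA; apply: le_trans (rinner_le _ _) _.
    by rewrite rnormN ler_wpM2r ?rnorm_ge0.
  rewrite /C0 rinnerDl rinnerNl rinnerZl rinnerxx.
  have -> : rinner (adjoint (A p) (A p x)) x = rnorm (A p x) ^+ 2.
    by rewrite /rinner (inner_adjointl (hA p)) innerxx.
  by lra.
have h6 : m ^+ 2 <= (V + 2 * k * e) ^+ 2 + e.
  rewrite -(@ler_pM2r _ (rnorm x ^+ 2)) ?exprn_gt0 //.
  by rewrite mulrDl; move: h4 h5; lra.
apply: le_trans h6 _.
apply: le_trans (_ : V ^+ 2 + e * D <= _); last by rewrite lerD2l.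
have h7 : e * e <= e by rewrite ler_piMr // ltW.
have h8 : 4 * k ^+ 2 * (e * e) <= 4 * k ^+ 2 * e.
  by rewrite ler_wpM2l // mulr_ge0 // sqr_ge0.
rewrite /D; move: h8; rewrite -subr_ge0 => h8; rewrite -subr_ge0.
by apply: le_trans h8 _; rewrite le_eqVlt; apply/orP; left; apply/eqP; ring.
Qed.

End NormalPolynomials.



(** The norm of a polynomial in [N] is its supremum over the spectrum, so [N] is
    dominated by [B] exactly when each point of the spectrum is, as a scalar
    operator; and a dominated scalar is a joint approximate eigenvalue. *)
Lemma lhd_normalP (R : realType) (H K : hilbertType R)
    (N : bounded_operator K) (B : bounded_operator H) : normal_operator N ->
  lhd N B <-> forall l, spectrum N l -> joint_approx_eigenvalue B l.
Proof.
move=> Nnormal; have hN := bounded_operatorP N; have hB := bounded_operatorP B.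
split=> [NB l /(spectrum_normalP _ Nnormal) hl|hl p].
  apply: joint_approx_of_value_le => // p; apply: le_trans (NB p).
  exact: joint_approx_value_le.
have [[v v0]|/forallNP triv] := pselect (exists v : K, v != 0).
  have [l /(spectrum_normalP _ Nnormal)/hl Bl] := normal_opnorm_attained hN Nnormal p v0.
  by move/le_trans; apply; exact: joint_approx_value_le.
have [m [m0 -> _]] := opnormP (linear_bounded_ncpoly hB (linear_bounded_adjoint hB) p).
apply: le_trans (_ : 0%:E <= _)%E; last by rewrite lee_fin.
apply: opnorm_le => // x.
have /negP : ~ x != 0 by exact: triv.
rewrite negbK => /eqP ->.
rewrite (linear_bounded0 (linear_bounded_ncpoly hN (linear_bounded_adjoint hN) p)).
by rewrite mul0r rnorm0.
Qed.

(** * Weighted shifts *)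

Section OrthonormalBasis.
Context {R : realType} {H : hilbertType R}.
Variable e : nat -> H.
Hypothesis he : orthonormal_basis e.
Implicit Types x y : H.

Lemma rnorm_basis k : rnorm (e k) = 1.
Proof.
have := rinnerxx (e k); rewrite /rinner (proj1 he) eqxx /= => /esym/eqP.
by rewrite sqrp_eq1 ?rnorm_ge0 // => /eqP.
Qed.

Lemma rnorm_basis_sum (c : nat -> R[i]) n m :
  rnorm (\sum_(0 <= k < m) c k *: e (n + k)%N) ^+ 2 = \sum_(0 <= k < m) rnorm (c k) ^+ 2.
Proof.
elim: m => [|m IH]; first by rewrite !big_geq // rnorm0 expr0n.
rewrite !big_nat_recr //= rnormD_sqr IH rnormZ.
have -> : rinner (\sum_(0 <= k < m) c k *: e (n + k)%N) (c m *: e (n + m)%N) = 0.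
  rewrite /rinner inner_suml big_nat big1 // => k /andP[_ km].
  by rewrite innerZl innerZr (proj1 he) eqn_add2l (ltn_eqF km) !mulr0.
by rewrite rnorm_basis mulr0 addr0 mulr1.
Qed.

Let psum x n := \sum_(0 <= k < n) inner x (e k) *: e k.

Lemma rnorm_psum x n : rnorm (psum x n) ^+ 2 = \sum_(0 <= k < n) rnorm (inner x (e k)) ^+ 2.
Proof. exact: (rnorm_basis_sum (fun k => inner x (e k)) 0). Qed.

Lemma bessel x n : \sum_(0 <= k < n) rnorm (inner x (e k)) ^+ 2 <= rnorm x ^+ 2.
Proof.
have h : rinner x (psum x n) = rnorm (psum x n) ^+ 2.
  rewrite rnorm_psum rinnerC /rinner inner_suml.
  rewrite (big_morph _ cReD (erefl : complex.Re 0 = 0)); apply: eq_bigr => k _.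
  by rewrite innerZl (innerC (e k)) mul_conj_rnorm.
have := sqr_ge0 (rnorm (x - psum x n)).
by rewrite rnormB_sqr h -rnorm_psum; lra.
Qed.

Lemma basis_psum_approx x (d : R) : 0 < d -> exists n, rnorm (x - psum x n) < d.
Proof.
move=> d0; have /cvg_rnorm /(_ d d0)[n hn] := proj2 he x.
by exists n; exact: (hn n (leqnn n)).
Qed.

Lemma parseval_le x (C : R) : 0 <= C ->
  (forall n, \sum_(0 <= k < n) rnorm (inner x (e k)) ^+ 2 <= C ^+ 2) -> rnorm x <= C.
Proof.
move=> C0 hC; apply/ler_addgt0Pr => d /(basis_psum_approx x)[n hn].
rewrite -(subrK (psum x n) x); apply: le_trans (rnormD _ _) _.
rewrite addrC lerD ?(ltW hn) //.
by rewrite -(@ler_pXn2r _ 2) ?nnegrE ?rnorm_ge0 // rnorm_psum.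
Qed.

Lemma basis_ext x y : (forall k, inner x (e k) = inner y (e k)) -> x = y.
Proof.
move=> h; apply/subr0_eq/rnorm_eq0/eqP; rewrite eq_le rnorm_ge0 andbT.
apply: parseval_le => // n; rewrite big1 ?expr0n //= => k _.
by rewrite innerBl h subrr rnorm0 expr0n.
Qed.

Lemma rnorm_le_coord x y (c : R) : 0 <= c ->
  (forall k, rnorm (inner x (e k)) <= c * rnorm (inner y (e k))) -> rnorm x <= c * rnorm y.
Proof.
move=> c0 h; apply: parseval_le => [|n]; first by rewrite mulr_ge0 ?rnorm_ge0.
rewrite exprMn; apply: le_trans (ler_wpM2l (sqr_ge0 c) (bessel y n)).
rewrite mulr_sumr; apply: ler_sum => k _; rewrite -exprMn.
by rewrite ler_pXn2r ?nnegrE ?mulr_ge0 ?rnorm_ge0.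
Qed.

End OrthonormalBasis.

Section WeightedShift.
Context {R : realType} {H : hilbertType R}.
Variables (e : nat -> H) (w : nat -> R) (T : H -> H).
Hypothesis he : orthonormal_basis e.
Hypothesis hT : linear_bounded T.
Hypothesis w_ge0 : forall n, 0 <= w n.
Hypothesis Te : forall n, T (e n) = (w n)%:C%C *: e n.+1.
Implicit Types (x y : H) (l : R[i]).

Let eE i j : inner (e i) (e j) = (i == j)%:R := proj1 he i j.

Lemma adjoint_shift_succ k : adjoint T (e k.+1) = (w k)%:C%C *: e k.
Proof.
apply: (basis_ext he) => j; rewrite (inner_adjointl hT) Te innerZr innerZl !eE conj_real eqSS.
by case: eqVneq => [->//|_]; rewrite !mulr0.
Qed.

Lemma adjoint_shift_zero : adjoint T (e 0%N) = 0.
Proof.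
apply: (basis_ext he) => j; rewrite (inner_adjointl hT) Te innerZr eE inner0l.
by rewrite mulr0.
Qed.

Lemma coord_shift_succ x k : inner (T x) (e k.+1) = (w k)%:C%C * inner x (e k).
Proof. by rewrite adjointP // adjoint_shift_succ innerZr conj_real. Qed.

Lemma coord_shift_zero x : inner (T x) (e 0%N) = 0.
Proof. by rewrite adjointP // adjoint_shift_zero inner0r. Qed.

Lemma coord_adjoint_shift x k : inner (adjoint T x) (e k) = (w k)%:C%C * inner x (e k.+1).
Proof. by rewrite inner_adjointl // Te innerZr conj_real. Qed.

(** [T^* T] is diagonal with entries the squared weights, and it acts on a
    joint approximate eigenvector almost as the scalar [|l| ^ 2]. *)
Lemma weight_near_joint_approx l : joint_approx_eigenvalue T l ->
  forall d : R, 0 < d -> exists n, `|w n - rnorm l| < d.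
Proof.
move=> hl d d0; apply: contrapT => /forallNP hw.
set r := rnorm l in hw.
have r0 : 0 <= r by exact: rnorm_ge0.
have hd n : d ^+ 2 <= `|w n ^+ 2 - r ^+ 2|.
  have /negP := hw n; rewrite -leNgt => h.
  rewrite subr_sqr normrM expr2 ler_pM // ?(ltW d0) //.
  apply: le_trans h _; rewrite [leRHS]ger0_norm ?addr_ge0 // ler_norml.
  by have wn := w_ge0 n; apply/andP; split; lra.
have [_ [M M0 hM]] := linear_bounded_adjoint hT.
have Mr : 0 < M + r + 1 by rewrite ltr_wpDl // addr_ge0.
have d2 : 0 < d ^+ 2 by rewrite exprn_gt0.
have [x [h1 h2]] := hl (d ^+ 2 / (M + r + 1)) (divr_gt0 d2 Mr).
have x0 := rnorm_gt0_of_lt (rnorm_ge0 _) h1.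
pose y := adjoint T (T x) - (r ^+ 2)%:C%C *: x.
have hy : rnorm x <= (d ^+ 2)^-1 * rnorm y.
  apply: (rnorm_le_coord he) => [|k]; first by rewrite invr_ge0 ltW.
  rewrite mulrC ler_pdivlMr // /y innerBl innerZl coord_adjoint_shift coord_shift_succ.
  rewrite mulrA -rmorphM -mulrBl -rmorphB /= rnormM rnorm_real -expr2 mulrC.
  by rewrite ler_wpM2r ?rnorm_ge0.
have : rnorm y <= (M + r) * (d ^+ 2 / (M + r + 1) * rnorm x).
  have -> : y = adjoint T (T x - l *: x) + l *: (adjoint T x - l^* *: x).
    have hT' := linear_bounded_adjoint hT.
    rewrite (linear_boundedB hT') (linear_boundedZ hT') scalerBr addrA subrK scalerA.
    by rewrite mul_conj_rnorm.
  apply: le_trans (rnormD _ _) _; rewrite rnormZ mulrDl lerD //.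
    by apply: le_trans (hM _) _; rewrite ler_wpM2l // ltW.
  by rewrite ler_wpM2l // ltW.
rewrite mulrC ler_pdivlMr // in hy.
move=> /(le_trans hy); set a := d ^+ 2 / _.
have -> : d ^+ 2 = a * (M + r + 1) by rewrite /a divfK // gt_eqF.
have : 0 < a * rnorm x by rewrite mulr_gt0 // divr_gt0.
by lra.
Qed.

(** The weights [w n], ..., [w (n + m)] are within [d] of [r], and [z] is a phase.
    The test vector avoids [e n], so that the adjoint also moves it inside the
    window, even when [n = 0]. *)
Section Window.
Variables (r : R) (z : R[i]).
Hypothesis r_ge0 : 0 <= r.
Hypothesis zz : z * z^* = 1.
Variables (n m : nat) (d : R).
Hypothesis window : forall j, (j <= m)%N -> `|w (n + j) - r| <= d.

Let f j := (z^*) ^+ j *: e (n + j)%N.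
Let x := \sum_(0 <= j < m) f j.+1.

Let rnorm_z : rnorm z = 1.
Proof.
move/(congr1 (@complex.Re R)): zz; rewrite mul_conj_rnorm /= => /eqP.
by rewrite sqrp_eq1 ?rnorm_ge0 // => /eqP.
Qed.

Let rnorm_f j : rnorm (f j) = 1.
Proof. by rewrite rnormZ rnormX rnorm_conj rnorm_z expr1n mul1r rnorm_basis. Qed.

Lemma rnorm_window : rnorm x ^+ 2 = m%:R.
Proof.
rewrite /x /f; under eq_bigr do rewrite addnS -addSn.
rewrite (rnorm_basis_sum he (fun j => z^* ^+ j.+1) n.+1 m).
under eq_bigr do rewrite rnormX rnorm_conj rnorm_z !expr1n.
by rewrite big_const_nat iter_addr_0 subn0.
Qed.

Let T_f j : T (f j) = z *: ((w (n + j))%:C%C *: f j.+1).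
Proof.
rewrite /f linear_boundedZ // Te addnS !scalerA; congr (_ *: _).
by rewrite exprS -[LHS]mul1r -zz; ring.
Qed.

Let T'_f j : adjoint T (f j.+1) = z^* *: ((w (n + j))%:C%C *: f j).
Proof.
rewrite /f linear_boundedZ ?addnS; last exact: linear_bounded_adjoint.
by rewrite adjoint_shift_succ !scalerA exprS; congr (_ *: _); ring.
Qed.

Let sum_small (c : nat -> R) (g : nat -> H) : (forall j, rnorm (g j) = 1) ->
  (forall j, (j < m)%N -> `|c j| <= d) ->
  rnorm (\sum_(0 <= j < m) (c j)%:C%C *: g j) <= d *+ m.
Proof.
move=> g1 hc; apply: le_trans (rnorm_sum _ _) _.
have -> : d *+ m = \sum_(0 <= j < m) d by rewrite sumr_const_nat subn0.
rewrite !big_nat; apply: ler_sum => j /andP[_ jm].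
by rewrite rnormZ g1 mulr1 rnorm_real hc.
Qed.

Let bound (g : nat -> H) (c : nat -> R) (a b : H) (t : R[i]) :
  rnorm t = 1 -> rnorm a = 1 -> rnorm b = 1 -> (forall j, rnorm (g j) = 1) ->
  (forall j, (j < m)%N -> `|c j| <= d) ->
  rnorm (t *: (\sum_(0 <= j < m) (c j)%:C%C *: g j + r%:C%C *: (a - b))) <= d *+ m + 2 * r.
Proof.
move=> t1 a1 b1 g1 hc; rewrite rnormZ t1 mul1r; apply: le_trans (rnormD _ _) _.
apply: lerD; first exact: sum_small.
rewrite rnormZ rnorm_real ger0_norm // mulrC ler_wpM2r //.
by apply: le_trans (rnormD _ _) _; rewrite rnormN a1 b1.
Qed.

Lemma window_approx : rnorm (T x - (r%:C%C * z) *: x) <= d *+ m + 2 * r.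
Proof.
have -> : T x - (r%:C%C * z) *: x = z *: (\sum_(0 <= j < m)
    (w (n + j.+1) - r)%:C%C *: f j.+2 + r%:C%C *: (f m.+1 - f 1%N)).
  rewrite /x (linear_bounded_sum hT) mulrC -scalerA.
  under eq_bigr do rewrite T_f; rewrite -scaler_sumr -scalerBr; congr (_ *: _).
  under [in RHS]eq_bigr do rewrite rmorphB scalerBl.
  rewrite sumrB -!scaler_sumr -addrA; congr (_ + _).
  rewrite -(telescope_sumr (fun j => f j.+1)) // sumrB scalerBr addrA.
  by rewrite addNr sub0r.
by apply: bound => // j jm; exact: window.
Qed.

Lemma window_adjoint_approx : rnorm (adjoint T x - (r%:C%C * z)^* *: x) <= d *+ m + 2 * r.
Proof.
have -> : adjoint T x - (r%:C%C * z)^* *: x = z^* *: (\sum_(0 <= j < m)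
    (w (n + j) - r)%:C%C *: f j + r%:C%C *: (f 0%N - f m)).
  rewrite /x (linear_bounded_sum (linear_bounded_adjoint hT)) rmorphM /= conj_real mulrC.
  rewrite -scalerA.
  under eq_bigr do rewrite T'_f; rewrite -scaler_sumr -scalerBr; congr (_ *: _).
  under [in RHS]eq_bigr do rewrite rmorphB scalerBl.
  rewrite sumrB -!scaler_sumr -addrA; congr (_ + _).
  rewrite -(opprB (f m)) -(telescope_sumr f) // sumrB scalerN scalerBr opprB addrA.
  by rewrite addNr sub0r.
by apply: bound => // [|j jm]; [rewrite rnorm_conj | apply: window; exact: ltnW].
Qed.

End Window.

(** Along a long stretch of weights close to [|l|], the vector whose entries
    are the powers of the conjugate phase of [l] is a joint approximate
    eigenvector: only the end points of the stretch contribute. *)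
Lemma joint_approx_of_windows l :
  (forall (d : R) m, 0 < d -> exists n, forall j, (j <= m)%N -> `|w (n + j) - rnorm l| <= d) ->
  joint_approx_eigenvalue T l.
Proof.
move=> hw eps eps0.
set r := rnorm l in hw.
have r0 : 0 <= r by exact: rnorm_ge0.
(* the phase of [l], or [1] when [l = 0] *)
have [z zz lz] : exists2 z : R[i], z * z^* = 1 & l = r%:C%C * z.
  have [l0|l0] := eqVneq l 0.
    by exists 1; rewrite ?rmorph1 ?mulr1 // /r l0 rnorm0.
  have rn0 : r%:C%C != 0 :> R[i].
    by apply/eqP => /complexI; apply/eqP; rewrite gt_eqF // rnorm_gt0.
  exists (l / r%:C%C); last by rewrite mulrC divfK.
  rewrite rmorphM fmorphV /= conj_real mulrACA mul_conj_rnorm -/r rmorphXn /=.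
  by rewrite -invfM -expr2 divff // expf_neq0.
(* the error is at most [2 * r + 1] once [d = 1 / (m + 1)], whereas the norm of
   the test vector is the square root of [m + 1] *)
have [m hm] : exists m : nat, (2 * r + 1) ^+ 2 < eps ^+ 2 * m.+1%:R.
  exists (Num.trunc ((2 * r + 1) ^+ 2 / eps ^+ 2)); rewrite [ltRHS]mulrC -ltr_pdivrMr ?exprn_gt0 //.
  exact: truncnS_gt.
have [n hn] := hw m.+1%:R^-1 m.+1 ltac:(by rewrite invr_gt0).
pose x := \sum_(0 <= j < m.+1) (z^* ^+ j.+1 *: e (n + j.+1)%N).
have xm : rnorm x ^+ 2 = m.+1%:R by exact: rnorm_window.
have lt : 2 * r + 1 < eps * rnorm x.
  rewrite -(@ltr_pXn2r _ 2) ?nnegrE ?mulr_ge0 ?rnorm_ge0 ?(ltW eps0) ?addr_ge0 ?mulr_ge0 //.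
  by rewrite exprMn xm.
have small : m.+1%:R^-1 *+ m.+1 + 2 * r = 2 * r + 1 :> R.
  by rewrite -[X in X + _]mulr_natr mulVf ?pnatr_eq0 // addrC.
exists x; split; apply: le_lt_trans lt; rewrite -small lz.
  exact: window_approx.
exact: window_adjoint_approx.
Qed.

(** Normality equates [|T e_n| = w n] with [|T^* e_n| = w (n - 1)], and
    [T^* e_0 = 0]. *)
Lemma shift_normal_weight0 : (forall x, T (adjoint T x) = adjoint T (T x)) ->
  forall n, w n = 0.
Proof.
move=> Tn; have eq n : rnorm (adjoint T (e n)) = w n.
  have := normal_rnorm_shift hT Tn 0 (e n).
  by rewrite rmorph0 !scale0r !subr0 => ->; rewrite Te rnormZ rnorm_basis // mulr1 rnorm_real ger0_norm.
elim=> [|n IH]; first by rewrite -eq adjoint_shift_zero rnorm0.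
by rewrite -eq adjoint_shift_succ IH scale0r rnorm0.
Qed.

Lemma shift_weight0 : (forall n, w n = 0) -> forall x, T x = 0.
Proof.
move=> w0 x; apply: (basis_ext he) => -[|k]; rewrite inner0l ?coord_shift_zero //.
by rewrite coord_shift_succ w0 mul0r.
Qed.

End WeightedShift.

Section LhdNormalRight.
Context {R : realType} {H K : hilbertType R}.

(** The commutator of the two variables vanishes at [N], hence at [T]. *)
Lemma lhd_normal_right (T : bounded_operator H) (N : bounded_operator K) :
  normal_operator N -> lhd T N -> normal_operator T.
Proof.
move=> Nn TN.
have hN := bounded_operatorP N; have hT := bounded_operatorP T.
pose mon (s : seq bool) : {fmonom bool} := FMonom s.
pose p : @ncpoly R := << 1 *g mon [:: false; true] >> + << -1 *g mon [:: true; false] >>.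
have pE (L : hilbertType R) (A : L -> L) x :
    ncpoly_eval p A (adjoint A) x = A (adjoint A x) - adjoint A (A x).
  by rewrite ncpoly_evalD !ncpoly_evalU /= scale1r scaleN1r.
have N0 : (opnorm (ncpoly_eval p N (adjoint N)) <= 0%:E)%E.
  by apply: opnorm_le => // x; rewrite pE Nn subrr rnorm0 mul0r.
have [m [_ Em hm]] := opnormP (linear_bounded_ncpoly hT (linear_bounded_adjoint hT) p).
have := le_trans (TN p) N0; rewrite Em lee_fin => m0 x.
apply/subr0_eq/rnorm_eq0/eqP; rewrite eq_le rnorm_ge0 andbT -pE.
by apply: le_trans (hm x) _; rewrite mulr_le0_ge0 ?rnorm_ge0.
Qed.

(** A dominated shift is normal, hence zero, and then [lhd_normalP] applies to
    [T] itself, whose spectrum is [0]. *)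
Lemma lhd_shift_normalP (e : nat -> H) (w : nat -> R) (T : bounded_operator H)
    (N : bounded_operator K) :
  orthonormal_basis e -> (forall n, 0 <= w n) ->
  (forall n, T (e n) = (w n)%:C%C *: e n.+1) -> normal_operator N ->
  lhd T N <-> (forall n, w n = 0) /\ spectrum N 0.
Proof.
move=> he w0 Te Nn; have hT := bounded_operatorP T.
split=> [TN|[wz N0]].
  have Tn := lhd_normal_right Nn TN.
  have wz := shift_normal_weight0 he hT w0 Te Tn.
  split=> //; apply/(spectrum_normalP _ Nn).
  apply: ((lhd_normalP N Tn).1 TN); apply/(spectrum_normalP _ Tn).
  apply/(joint_approx_normalP hT Tn) => d d0; exists (e 0%N).
  by rewrite (shift_weight0 he hT Te wz) scale0r subr0 rnorm0 rnorm_basis // mulr1.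
have T0 := shift_weight0 he hT Te wz.
have Tn : normal_operator T.
  by move=> x; rewrite !T0 (linear_bounded0 (linear_bounded_adjoint hT)).
apply/(lhd_normalP N Tn) => l /(spectrum_normalP _ Tn)/(joint_approx_normalP hT Tn) hl.
have [->|/rnorm_gt0/hl[x]] := eqVneq l 0; first exact/(spectrum_normalP _ Nn).
by rewrite T0 sub0r rnormN rnormZ ltxx.
Qed.

End LhdNormalRight.

(** * Measurability *)

Lemma countable_bigcup_measurable d (T : measurableType d) (I : countType)
    (F : I -> set T) : (forall i, measurable (F i)) -> measurable (\bigcup_i F i).
Proof.
by move=> mF; exact: countable_bigcupT_measurable.
Qed.

Lemma countable_bigcap_measurable d (T : measurableType d) (I : countType)
    (F : I -> set T) : (forall i, measurable (F i)) -> measurable (\bigcap_i F i).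
Proof.
move=> mF; rewrite -[X in measurable X]setCK setC_bigcap; apply: measurableC.
by apply: countable_bigcup_measurable => i; exact: measurableC.
Qed.

Lemma countable_negligible_bigcup d (T : measurableType d) (R : realType)
    (mu : {measure set T -> \bar R}) (I : countType) (F : I -> set T) :
  (forall i, mu.-negligible (F i)) -> mu.-negligible (\bigcup_i F i).
Proof.
move=> nF.
pose G n := if (choice.unpickle n : option I) is Some i then F i else set0.
apply: (@negligibleS _ _ _ _ (\bigcup_n G n)).
  by move=> x [i _ Fi]; exists (choice.pickle i) => //; rewrite /G choice.pickleK.
by apply: negligible_bigcup => n; rewrite /G; case: choice.unpickle => [i|]; [exact: nF | exact: negligible_set0].
Qed.

Section RationalVectors.
Context {R : realType} {H : hilbertType R}.
Variable e : nat -> H.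
Hypothesis he : orthonormal_basis e.

Definition rat_complex (q : rat * rat) : R[i] := (ratr q.1 +i* ratr q.2)%C.

Definition rat_vector (s : seq (rat * rat)) : H :=
  \sum_(0 <= k < size s) rat_complex (nth (0, 0) s k) *: e k.

Lemma rat_approx (a d : R) : 0 < d -> exists q : rat, `|a - ratr q| < d.
Proof.
move=> d0; have [|q] := @rat_in_itvoo R (a - d) (a + d); first by lra.
rewrite in_itv /= => /andP[h1 h2]; exists q; rewrite ltr_norml.
by apply/andP; split; lra.
Qed.

Lemma rat_complex_approx (c : R[i]) (d : R) : 0 < d ->
  exists q, rnorm (c - rat_complex q) < d.
Proof.
move=> d0; case: c => a b.
have d2 : 0 < d / 2 by rewrite divr_gt0.
have [p hp] := rat_approx a d2; have [q hq] := rat_approx b d2.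
exists (p, q); rewrite -(@ltr_pXn2r _ 2) ?nnegrE ?rnorm_ge0 ?(ltW d0) // rnorm_sqr /=.
have sq (x : R) : `|x| < d / 2 -> x ^+ 2 <= (d / 2) ^+ 2.
  by move=> hx; rewrite -real_normK ?num_real // ler_pXn2r ?nnegrE ?(ltW d2) // ltW.
have := sq _ hp; have := sq _ hq.
have : 0 < d ^+ 2 by rewrite exprn_gt0.
by rewrite exprMn exprVn; lra.
Qed.

Lemma rat_vector_approx x (d : R) : 0 < d -> exists s, rnorm (x - rat_vector s) < d.
Proof.
move=> d0; have d2 : 0 < d / 2 by rewrite divr_gt0.
have [n hn] := basis_psum_approx he x d2.
have dn : 0 < d / 2 / n.+1%:R by rewrite divr_gt0.
have /choice[q hq] := fun k => rat_complex_approx (inner x (e k)) dn.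
exists (mkseq q n); rewrite /rat_vector size_mkseq.
set u := \sum_(0 <= k < n) _ *: _ in hn; set v := \sum_(0 <= k < n) _ *: _.
have uv : rnorm (u - v) <= d / 2.
  rewrite /u /v -sumrB; apply: le_trans (rnorm_sum _ _) _.
  apply: le_trans (_ : \sum_(0 <= k < n) d / 2 / n.+1%:R <= _).
    rewrite !big_nat; apply: ler_sum => k /andP[_ kn].
    by rewrite nth_mkseq // -scalerBl rnormZ rnorm_basis // mulr1 ltW.
  rewrite sumr_const_nat subn0 -[X in X <= _]mulr_natr mulrAC -mulrA.
  rewrite -[leRHS]mulr1 ler_wpM2l ?(ltW d2) //.
  by rewrite ler_pdivrMr // mul1r ler_nat.
rewrite -(subrK u x) -addrA; apply: le_lt_trans (rnormD _ _) _.
by move: hn uv; lra.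
Qed.

(** An almost joint eigenvector can be perturbed into the countable set of
    rational vectors since the conditions on it are open. *)
Lemma joint_approx_rat (A : H -> H) l : linear_bounded A -> joint_approx_eigenvalue A l ->
  forall eps : R, 0 < eps -> exists s, rat_vector s != 0 /\
    (rnorm (A (rat_vector s) - l *: rat_vector s) <= eps * rnorm (rat_vector s) /\
     rnorm (adjoint A (rat_vector s) - l^* *: rat_vector s) <= eps * rnorm (rat_vector s)).
Proof.
move=> hA hl eps eps0.
have [_ [M M0 hM]] := hA; have hM' := adjoint_bound hA M0 hM.
have eps2 : 0 < eps / 2 by rewrite divr_gt0.
have [x [h1 h2]] := hl _ eps2.
have x0 := rnorm_gt0_of_lt (rnorm_ge0 _) h1.
set L := M + rnorm l + eps.
have Leps : eps <= L by rewrite lerDr addr_ge0 ?rnorm_ge0.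
have L0 : 0 < L by apply: lt_le_trans Leps.
have d0 : 0 < eps / 2 * rnorm x / L by rewrite divr_gt0 // mulr_gt0.
have [s hs] := rat_vector_approx x d0; exists s.
move: (rat_vector s) hs => y; rewrite ltr_pdivlMr // => hs.
have hxy : rnorm x <= rnorm y + rnorm (x - y).
  by rewrite -{1}(subrK y x) addrC; exact: rnormD.
have n0 := rnorm_ge0 (x - y).
have gen (B : H -> H) (t : R[i]) : linear_bounded B -> rnorm t = rnorm l ->
    (forall x, rnorm (B x) <= M * rnorm x) ->
    rnorm (B x - t *: x) < eps / 2 * rnorm x -> rnorm (B y - t *: y) <= eps * rnorm y.
  move=> hB tl hBM hx.
  have -> : B y - t *: y = (B x - t *: x) - (B (x - y) - t *: (x - y)).
    by rewrite (linear_boundedB hB) scalerBr; apply: inner_ext => z;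
       rewrite !(innerDl, innerBl, innerNl, innerZl); ring.
  apply: le_trans (rnormD _ _) _; rewrite rnormN.
  have h3 : rnorm (B (x - y) - t *: (x - y)) <= (M + rnorm l) * rnorm (x - y).
    apply: le_trans (rnormD _ _) _; rewrite rnormN rnormZ tl mulrDl lerD2r.
    exact: hBM.
  have h4 := ler_wpM2l (ltW eps0) hxy.
  by move: hs h3 h4 hx; rewrite /L; lra.
split; last by split; [exact: gen | apply: gen => //;
  [exact: linear_bounded_adjoint | exact: rnorm_conj]].
have xy : rnorm (x - y) < rnorm x.
  have : rnorm (x - y) * eps <= rnorm (x - y) * L by rewrite ler_wpM2l.
  have := mulr_gt0 eps0 x0; move: hs; set p := rnorm _ * L.
  move=> h3 h4 h5; rewrite -(ltr_pM2l eps0).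
  by move: h3 h4 h5; lra.
by apply: contraTneq xy => ->; rewrite subr0 ltxx.
Qed.

(** The countable form of an uncountable family of conditions: only rational
    points near the set and rational vectors are tested. *)
Lemma joint_approx_countable (A : H -> H) (D : set R[i]) : linear_bounded A ->
  (forall l, D l -> joint_approx_eigenvalue A l) <->
  (forall (k : nat) (q : rat * rat),
     (exists2 l, D l & rnorm (l - rat_complex q) <= k.+1%:R^-1) ->
     exists s, rat_vector s != 0 /\
       (rnorm (A (rat_vector s) - rat_complex q *: rat_vector s) <=
          2 / k.+1%:R * rnorm (rat_vector s) /\
        rnorm (adjoint A (rat_vector s) - (rat_complex q)^* *: rat_vector s) <=
          2 / k.+1%:R * rnorm (rat_vector s))).
Proof.
have tri (x u : H) (t t' : R[i]) (a b : R) : rnorm (t - t') <= a ->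
    rnorm (u - t *: x) <= b * rnorm x -> rnorm (u - t' *: x) <= (b + a) * rnorm x.
  move=> h1 h2; rewrite (_ : u - t' *: x = (u - t *: x) + (t - t') *: x); last first.
    by rewrite scalerBl addrA subrK.
  apply: le_trans (rnormD _ _) _; rewrite mulrDl lerD // rnormZ.
  by rewrite ler_wpM2r ?rnorm_ge0.
have conjB (t t' : R[i]) : rnorm (t^* - t'^*) = rnorm (t - t').
  by rewrite -rmorphB rnorm_conj.
move=> hA; split=> [hD k q [l Dl lq]|hk l Dl eps eps0].
  have k0 : 0 < k.+1%:R^-1 :> R by rewrite invr_gt0.
  have [s [s0 [h1 h2]]] := joint_approx_rat hA (hD l Dl) k0.
  exists s; split=> //; rewrite mulrDl mul1r.
  by split; [apply: tri h1 | apply: tri h2; rewrite conjB].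
have eps3 : 0 < eps / 3 by rewrite divr_gt0.
have [k] := ltr_add_invr (y := 0) (x := eps / 3) eps3; rewrite add0r => hk3.
have k0 : 0 < k.+1%:R^-1 :> R by rewrite invr_gt0.
have [q hq] := rat_complex_approx l k0.
have [|s [s0 [h1 h2]]] := hk k q; first by exists l => //; exact: ltW.
exists (rat_vector s).
have s1 := rnorm_gt0 s0.
have lt3 : (2 / k.+1%:R + k.+1%:R^-1) * rnorm (rat_vector s) < eps * rnorm (rat_vector s).
  by rewrite ltr_pM2r //; move: hk3; move: (k.+1%:R^-1) => t ht; lra.
split; apply: le_lt_trans lt3; first by apply: tri h1; rewrite rnormB ltW.
by apply: tri h2; rewrite conjB rnormB ltW.
Qed.

End RationalVectors.

Section MeasurableShift.
Context {R : realType} {H : hilbertType R}.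
Variable e : nat -> H.
Hypothesis he : orthonormal_basis e.
Context {d : measure_display} {Omega : measurableType d}.

(** By Parseval the condition is that all partial sums of the squared
    coordinates stay below [C ^ 2]. *)
Lemma measurable_rnorm_le (f : Omega -> H) (C : R) : 0 <= C ->
  (forall k, exists (Y : Omega -> R) (a b : R[i]), measurable_fun setT Y /\
     forall om, inner (f om) (e k) = (Y om)%:C%C * a - b) ->
  measurable [set om | rnorm (f om) <= C].
Proof.
move=> C0 hf.
have -> : [set om | rnorm (f om) <= C] = \bigcap_n
    [set om | \sum_(0 <= k < n) rnorm (inner (f om) (e k)) ^+ 2 <= C ^+ 2].
  apply/seteqP; split=> om /=.
    move=> h n _ /=; apply: le_trans (bessel he _ n) _.
    by rewrite ler_pXn2r ?nnegrE ?rnorm_ge0.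
  by move=> h; apply: (parseval_le he) => // n; exact: h.
apply: bigcapT_measurable => n.
pose g (k : nat) om := rnorm (inner (f om) (e k)) ^+ 2.
have mg k : measurable_fun setT (g k).
  have [Y [a [b [mY hY]]]] := hf k.
  have -> : g k = (fun om => (Y om * complex.Re a - complex.Re b) ^+ 2 +
                             (Y om * complex.Im a - complex.Im b) ^+ 2).
    apply/funext => om; rewrite /g hY rnorm_sqr; clear hY.
    by case: a b => [a1 a2] [b1 b2] /=; rewrite mul0r subr0 mul0r addr0.
  by apply: measurable_funD; apply: measurable_funX; apply: measurable_funB => //;
     apply: measurable_funM.
have mG : measurable_fun setT (fun om => \sum_(0 <= k < n) g k om).
  exact: measurable_sum.
rewrite (_ : mkset _ = (fun om => \sum_(0 <= k < n) g k om) @^-1` `]-oo, C ^+ 2]).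
  by rewrite -[X in measurable X]setTI; apply: mG => //; exact: measurable_itv.
by apply/seteqP; split=> om /=; rewrite in_itv.
Qed.

Variables (X : nat -> Omega -> R) (T : Omega -> bounded_operator H).
Hypothesis mX : forall n, measurable_fun setT (X n).
Hypothesis Te : forall om n, T om (e n) = (X n om)%:C%C *: e n.+1.

Lemma measurable_joint_approx (D : set R[i]) :
  measurable [set om | forall l, D l -> joint_approx_eigenvalue (T om) l].
Proof.
pose G (k : nat) (q : rat * rat) (s : seq (rat * rat)) :=
  [set om | rnorm (T om (rat_vector e s) - rat_complex q *: rat_vector e s) <=
          2 / k.+1%:R * rnorm (rat_vector e s)] `&`
  [set om | rnorm (adjoint (T om) (rat_vector e s) - (rat_complex q)^* *: rat_vector e s) <=
          2 / k.+1%:R * rnorm (rat_vector e s)].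
have mG k q s : measurable (G k q s).
  have C0 : 0 <= 2 / k.+1%:R * rnorm (rat_vector e s).
    by rewrite mulr_ge0 ?rnorm_ge0 // divr_ge0.
  rewrite /G; move: (rat_vector e s) C0 => x C0.
  apply: measurableI; apply: measurable_rnorm_le => //.
    case=> [|k'].
      exists (fun=> 0), 0, (rat_complex q * inner x (e 0%N)); split=> // om.
      rewrite innerBl innerZl (coord_shift_zero he (bounded_operatorP _) (Te om)).
      by rewrite mulr0.
    exists (X k'), (inner x (e k')), (rat_complex q * inner x (e k'.+1)); split=> // om.
    by rewrite innerBl innerZl (coord_shift_succ he (bounded_operatorP _) (Te om)).
  move=> k'; exists (X k'), (inner x (e k'.+1)), ((rat_complex q)^* * inner x (e k')).
  split=> // om.
  by rewrite innerBl innerZl (coord_adjoint_shift (bounded_operatorP _) (Te om)).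
pose near k q := exists2 l, D l & rnorm (l - rat_complex q) <= k.+1%:R^-1.
rewrite (_ : mkset _ = \bigcap_(kq : nat * (rat * rat))
    (if `[< near kq.1 kq.2 >] then \bigcup_(s : seq (rat * rat))
       (if rat_vector e s != 0 then G kq.1 kq.2 s else set0) else setT)).
  apply: countable_bigcap_measurable => -[k q] /=; case: ifP => // _.
  by apply: countable_bigcup_measurable => s; case: ifP.
apply/seteqP; split=> om /=.
  move/(joint_approx_countable he D (bounded_operatorP (T om))) => h [k q] _ /=.
  case: asboolP => // /h[s [s0 [h1 h2]]].
  by exists s => //; rewrite s0; split.
move=> h; apply/(joint_approx_countable he D (bounded_operatorP (T om))) => k q nkq.
have := h (k, q) I => /=; case: asboolP => // _ [s _].
by case: ifP => // s0 [h1 h2]; exists s.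
Qed.

End MeasurableShift.

(** * Independent identically distributed weights *)

Lemma le0_of_le_expr (R : realType) (x t : R) : 0 <= t < 1 ->
  (forall n, x <= t ^+ n) -> x <= 0.
Proof.
move=> /andP[t0 t1] h.
rewrite leNgt; apply/negP => x0.
have t1' : `|t| < 1 by rewrite ger0_norm.
have /cvgrPdist_lt /(_ x x0)[n _ /(_ n (leqnn n))] := cvg_expr t1'.
by rewrite /= sub0r normrN ger0_norm ?exprn_ge0 // ltNge h.
Qed.

(** By induction on [L]: the event for [L + 1] is the event for [L] minus its
    intersection with [E L], which is the event for [L] with [L] added to [s]. *)
Lemma prob_complements_product d (Omega : measurableType d) (R : realType)
    (P : probability Omega R) (E : nat -> set Omega) (q : R) :
  (forall k, measurable (E k)) ->
  (forall s : seq nat, uniq s -> P (\bigcap_(k in [set` s]) E k) = (q ^+ size s)%:E) ->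
  forall L s, uniq s -> all (leq L) s ->
  P (\bigcap_(k in [set k | (k < L)%N]) ~` E k `&` \bigcap_(k in [set` s]) E k) =
    ((1 - q) ^+ L * q ^+ size s)%:E.
Proof.
move=> mE hE; elim=> [|L IH] s us Ls.
  rewrite (_ : [set k | (k < 0)%N] = set0); last by apply/seteqP; split.
  by rewrite bigcap_set0 setTI hE // mul1r.
have Ls' : all (leq L) s by apply: sub_all Ls => k; exact: ltnW.
have uLs : uniq (L :: s).
  rewrite /= us andbT; apply/negP => sL.
  by have := allP Ls _ sL; rewrite ltnn.
set C := \bigcap_(k in [set` s]) E k.
set D := \bigcap_(k in [set k | (k < L)%N]) ~` E k.
have -> : \bigcap_(k in [set k | (k < L.+1)%N]) ~` E k `&` C = (D `&` C) `\` E L.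
  apply/seteqP; split=> om.
    move=> [h1 h2]; split; last by apply: h1 => /=.
    by split=> // k /= kL; apply: h1 => /=; exact: ltnW.
  move=> [[h1 h2] h3]; split=> // k /=; rewrite ltnS leq_eqVlt => /orP[/eqP ->//|].
  exact: h1.
have mD : measurable D by apply: bigcap_measurableType => k _; exact: measurableC.
have mC : measurable C by exact: bigcap_measurableType.
have mDC : measurable (D `&` C) by exact: measurableI.
have PDC := IH s us Ls'; rewrite -/D -/C in PDC.
have fin : (P (D `&` C) < +oo)%E by rewrite PDC ltry.
have -> : P ((D `&` C) `\` E L) = (P (D `&` C) - P ((D `&` C) `&` E L))%E.
  exact: measureD.
have -> : (D `&` C) `&` E L = D `&` \bigcap_(k in [set` L :: s]) E k.
  apply/seteqP; split=> om.
    move=> [[h1 h2] h3]; split=> // k /=; rewrite inE => /orP[/eqP ->//|].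
    exact: h2.
  move=> [h1 h2]; split; last by apply: h2; rewrite /= inE eqxx.
  by split=> // k /= ks; apply: h2; rewrite /= inE ks orbT.
rewrite PDC /D IH //=; last by rewrite leqnn.
by rewrite -EFinB; congr (_%:E); rewrite !exprS; ring.
Qed.

Lemma prob1_of_negligible d (Omega : measurableType d) (R : realType)
    (P : probability Omega R) (A : set Omega) :
  measurable A -> P.-negligible (~` A) -> P A = 1%E.
Proof.
move=> mA nA; have PC : P (~` A) = 0%E by apply/negligibleP => //; exact: measurableC.
by rewrite -[A]setCK probability_setC ?PC ?sube0 //; exact: measurableC.
Qed.

Section IID.
Context {d : measure_display} {Omega : measurableType d} {R : realType}.
Variables (P : probability Omega R) (X : nat -> {RV P >-> R}).
Hypothesis Xindep : mutually_independent X.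
Hypothesis Xid : identically_distributed X.
Implicit Types A : set R.

Lemma measurable_RV n : measurable_fun setT (X n : Omega -> R).
Proof. exact: measurable_funPT. Qed.

Lemma measurable_RV_preimage n A : measurable A -> measurable (X n @^-1` A).
Proof.
by move=> mA; rewrite -[X in measurable X]setTI; apply: measurable_RV.
Qed.

Definition law A : R := fine (P (X 0%N @^-1` A)).

Lemma prob_law n A : measurable A -> P (X n @^-1` A) = (law A)%:E.
Proof.
move=> mA; have := Xid n mA; rewrite /distribution /pushforward => ->.
by rewrite /law fineK // fin_num_measure //; exact: measurable_RV_preimage.
Qed.

Lemma law_ge0 A : 0 <= law A.
Proof. exact: fine_ge0. Qed.

Lemma law_le1 A : measurable A -> law A <= 1.
Proof.
move=> mA; rewrite -lee_fin -(prob_law 0) //.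
by apply: probability_le1; exact: measurable_RV_preimage.
Qed.

Lemma law_setC A : measurable A -> law (~` A) = 1 - law A.
Proof.
move=> mA; apply: EFin_inj; rewrite EFinB -!(prob_law 0) //; last exact: measurableC.
by rewrite -probability_setC //; exact: measurable_RV_preimage.
Qed.

Lemma law0_negligible n A : measurable A -> law A = 0 -> P.-negligible (X n @^-1` A).
Proof.
move=> mA A0; apply/negligibleP; first exact: measurable_RV_preimage.
by have := prob_law n mA; rewrite A0.
Qed.

Lemma prob_all_in (s : seq nat) A : measurable A -> uniq s ->
  P (\bigcap_(n in [set` s]) (X n @^-1` A)) = (law A ^+ size s)%:E.
Proof.
move=> mA us; have := Xindep [fset n | n in s]%fset (fun=> mA).
rewrite (_ : [set` [fset n | n in s]%fset] = [set` s]); last first.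
  by apply/seteqP; split=> n; rewrite /= in_fset.
move=> ->.
have prodE (t : seq nat) :
    (\prod_(n <- t) P (X n @^-1` A) = (law A ^+ size t)%:E)%E.
  elim: t => [|n t IH]; first by rewrite big_nil.
  by rewrite big_cons IH prob_law // -EFinM exprS.
by rewrite prodE card_fseq undup_id.
Qed.

Let block M A k : set Omega := \bigcap_(j in [set j | (j < M)%N]) (X (k * M + j)%N @^-1` A).

Lemma prob_all_blocks M A (s : seq nat) : measurable A -> uniq s ->
  P (\bigcap_(k in [set` s]) block M A k) = ((law A ^+ M) ^+ size s)%:E.
Proof.
move=> mA us.
have -> : \bigcap_(k in [set` s]) block M A k =
    \bigcap_(n in [set` [seq (k * M + j)%N | k <- s, j <- iota 0 M]]) (X n @^-1` A).
  apply/seteqP; split=> om h.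
    move=> n /= /allpairsP[[k j] /= [ks]].
    by rewrite mem_iota add0n => jM ->; exact: h.
  move=> k /= ks j /= jM; apply: (h (k * M + j)%N) => /=.
  by apply/allpairsP; exists (k, j); rewrite /= ks mem_iota add0n.
rewrite prob_all_in //; last first.
  apply: allpairs_uniq => //; first exact: iota_uniq.
  move=> [k j] [k' j'] /allpairsP[[? ?] /= [_ + [-> ->]]] /allpairsP[[? ?] /= [_ + [-> ->]]].
  rewrite !mem_iota !add0n => jM j'M /= eq.
  have M0 : (0 < M)%N by apply: leq_ltn_trans jM.
  have := congr1 (divn^~ M) eq; have := congr1 (modn^~ M) eq.
  by rewrite /= !modnMDl !divnMDl // !modn_small // !divn_small // !addn0 => -> ->.
by rewrite size_allpairs size_iota mulnC exprM.
Qed.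

(** Disjoint blocks of weights are independent, so almost surely one of them
    lies inside any given set of positive law. *)
Lemma windows_negligible M A : measurable A -> 0 < law A ->
  P.-negligible [set om | forall n, exists2 j, (j < M)%N & ~ A (X (n + j)%N om)].
Proof.
move=> mA A0.
have mE k : measurable (block M A k).
  by apply: bigcap_measurableType => j _; exact: measurable_RV_preimage.
set q := law A ^+ M.
have q0 : 0 < q by rewrite exprn_gt0.
have q1 : q <= 1 by rewrite exprn_ile1 ?law_ge0 ?law_le1.
pose Z := \bigcap_k ~` block M A k.
have mZ : measurable Z by apply: bigcapT_measurable => k; exact: measurableC.
apply: (@negligibleS _ _ _ _ Z).
  move=> om /= h k _ hk; have [j jM] := h (k * M)%N; apply.
  exact: hk.
suff PZ0 : P Z = 0%E by apply/negligibleP.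
have finZ : P Z \is a fin_num by exact: fin_num_measure.
have hZ n : fine (P Z) <= (1 - q) ^+ n.
  rewrite -lee_fin fineK //.
  have := @prob_complements_product _ _ _ P _ q mE
    (fun s us => prob_all_blocks M mA us) n [::] erefl erefl.
  rewrite /= expr0 mulr1 => <-; apply: le_measure; rewrite ?inE //.
    apply: measurableI; first by apply: bigcap_measurableType => k _; exact: measurableC.
    by apply: bigcap_measurableType => k _.
  by move=> om h; split=> k // _; exact: h.
apply/eqP; rewrite -(fineK finZ) eqe eq_le fine_ge0 // andbT.
apply: le0_of_le_expr hZ; rewrite subr_ge0 q1 /=.
by rewrite ltrBlDr ltrDl.
Qed.

Lemma not_essran_law t : ~ essran (X 0%N) t ->
  exists U : set R, [/\ open U, U t & law U = 0].
Proof.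
move=> /existsNP[U] /not_implyP[oU] /not_implyP[Ut] /negP; rewrite -leNgt => h.
exists U; split=> //; have mU := open_measurable oU.
apply/eqP; rewrite eq_le law_ge0 andbT -lee_fin -(prob_law 0) //.
Qed.

Lemma essran_law_gt0 t (U : set R) : open U -> U t -> essran (X 0%N) t -> 0 < law U.
Proof.
by move=> oU Ut /(_ U oU Ut); rewrite /distribution /pushforward prob_law ?lte_fin //;
   exact: open_measurable.
Qed.

(** The points outside the support are covered by countably many null rational
    intervals, so a support reduced to [0] carries the whole law. *)
Lemma essran0_law : essran (X 0%N) = [set 0] <-> law [set 0] = 1.
Proof.
have m0 : measurable [set (0 : R)] by exact: measurable_set1.
split=> [h|h].
  apply/eqP; rewrite eq_sym -subr_eq0 -law_setC //; apply/eqP.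
  apply: EFin_inj; rewrite -(prob_law 0); last exact: measurableC.
  apply/negligibleP; first by apply: measurable_RV_preimage; exact: measurableC.
  pose F (q : rat * rat) := if law `]ratr q.1, ratr q.2[%classic == 0
    then X 0%N @^-1` `]ratr q.1, ratr q.2[%classic else set0.
  apply: (@negligibleS _ _ _ _ (\bigcup_q F q)); last first.
    apply: countable_negligible_bigcup => q; rewrite /F; case: eqP => [q0|_]; last exact: negligible_set0.
    by apply: law0_negligible => //; exact: measurable_itv.
  move=> om /= om0.
  have [|U [oU Ut U0]] := @not_essran_law (X 0%N om) _; first by rewrite h.
  have /nbhs_ballP[r /= r0 rU] : nbhs (X 0%N om) U by exact: open_nbhs_nbhs.
  have [|a] := @rat_in_itvoo R (X 0%N om - r) (X 0%N om); first by rewrite gtrBl.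
  rewrite in_itv /= => /andP[a1 a2].
  have [|b] := @rat_in_itvoo R (X 0%N om) (X 0%N om + r); first by rewrite ltrDl.
  rewrite in_itv /= => /andP[b1 b2].
  exists (a, b) => //; rewrite /F /=.
  have abU : `]ratr a, ratr b[%classic `<=` U.
    move=> x /=; rewrite in_itv /= => /andP[x1 x2]; apply: rU.
    by rewrite /ball /= ltr_norml; apply/andP; split; lra.
  have -> : law `]ratr a, ratr b[%classic = 0.
    apply/eqP; rewrite eq_le law_ge0 andbT -U0 -lee_fin -!(prob_law 0) //.
    - apply: le_measure; rewrite ?inE; try exact: measurable_RV_preimage.
      + by apply: measurable_RV_preimage; exact: open_measurable.
      + by move=> x; exact: abU.
    - exact: open_measurable.
  by rewrite eqxx /= in_itv /= a2 b1.
apply/seteqP; split=> t.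
  move=> ht; apply: contrapT => t0.
  have o0 : open (~` [set (0 : R)]) by apply: closed_openC; exact: closed_eq.
  have := ht _ o0 t0; rewrite /distribution /pushforward prob_law; last exact: measurableC.
  by rewrite law_setC // h subrr ltxx.
move=> -> U oU U0; have mU := open_measurable oU.
have h1 : (P (X 0%N @^-1` [set 0%R]) <= P (X 0%N @^-1` U))%E.
  apply: le_measure; rewrite ?inE; try exact: measurable_RV_preimage.
  by move=> x /= ->.
rewrite !prob_law // lee_fin h in h1.
by rewrite /distribution /pushforward prob_law // lte_fin; apply: lt_le_trans h1.
Qed.

Lemma measurable_all0 : measurable (\bigcap_n (X n @^-1` [set 0])).
Proof.
by apply: bigcapT_measurable => n; apply: measurable_RV_preimage; exact: measurable_set1.
Qed.

(** Unless the law is the Dirac mass at [0], independence bounds the probability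
    by all the powers of [law [set 0] < 1]. *)
Lemma prob_all0 : P (\bigcap_n (X n @^-1` [set 0])) =
  if `[< essran (X 0%N) = [set 0] >] then 1%E else 0%E.
Proof.
have m0 : measurable [set (0 : R)] by exact: measurable_set1.
have mA := measurable_all0.
case: asboolP => [/essran0_law h|hn].
  have hC : P.-negligible (~` \bigcap_n (X n @^-1` [set 0])).
    rewrite setC_bigcap; apply: negligible_bigcup => n.
    rewrite (_ : ~` _ = X n @^-1` (~` [set 0])) //.
    apply: law0_negligible; first exact: measurableC.
    by rewrite law_setC // h subrr.
  exact: prob1_of_negligible.
have law_lt1 : law [set 0] < 1.
  by rewrite lt_def law_le1 // andbT; apply: contra_notN hn => /eqP h; apply/essran0_law.
have finA : P (\bigcap_n (X n @^-1` [set 0])) \is a fin_num by exact: fin_num_measure.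
rewrite -(fineK finA); congr (_%:E); apply/eqP; rewrite eq_le fine_ge0 // andbT.
apply: (@le0_of_le_expr _ _ (law [set 0])); first by rewrite law_ge0.
move=> n; rewrite -lee_fin fineK // -(size_iota 0 n) -prob_all_in ?iota_uniq //.
apply: le_measure; rewrite ?inE //.
  by apply: bigcap_measurableType => k _; exact: measurable_RV_preimage.
by move=> om h k _; exact: h.
Qed.

End IID.

(** * Random weighted shifts and normal operators *)

Section RandomShift.
Context {d : measure_display} {Omega : measurableType d} {R : realType}.
Variables (P : probability Omega R) (X : nat -> {RV P >-> R}).
Hypothesis Xindep : mutually_independent X.
Hypothesis Xid : identically_distributed X.
Hypothesis Xge0 : forall n omega, 0 <= X n omega.
Context {H : hilbertType R} {e : nat -> H}.
Hypothesis he : orthonormal_basis e.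
Variable T : Omega -> bounded_operator H.
Hypothesis hT : random_weighted_shift e X T.

(** Almost surely, simultaneously for the countably many rational intervals of
    positive law, there are windows of every length in the interval; any [l] with
    [|l|] in the support then has windows around [|l|]. *)
Lemma ae_joint_approx :
  P.-negligible (~` [set om | forall l, essran (X 0%N) (rnorm l) ->
    joint_approx_eigenvalue (T om) l]).
Proof.
pose I (q : rat * rat) : set R := `]ratr q.1, ratr q.2[%classic.
pose F (qm : (rat * rat) * nat) := if 0 < law X (I qm.1) then
  [set om | forall n, exists2 j, (j < qm.2.+1)%N & ~ I qm.1 (X (n + j)%N om)] else set0.
apply: (@negligibleS _ _ _ _ (\bigcup_qm F qm)); last first.
  apply: countable_negligible_bigcup => -[q m]; rewrite /F /=.
  case: ifP => [q0|_]; last exact: negligible_set0.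
  by apply: windows_negligible => //; exact: measurable_itv.
move=> om; rewrite -[X in _ -> X]notK => /= hl hF; apply: hl => l hl.
apply: (joint_approx_of_windows he (bounded_operatorP (T om)) (hT om)) => c m c0.
have [|a] := @rat_in_itvoo R (rnorm l - c) (rnorm l); first by rewrite gtrBl.
rewrite in_itv /= => /andP[a1 a2].
have [|b] := @rat_in_itvoo R (rnorm l) (rnorm l + c); first by rewrite ltrDl.
rewrite in_itv /= => /andP[b1 b2].
have q0 : 0 < law X (I (a, b)).
  apply: (essran_law_gt0 Xid _ _ hl); first exact: interval_open.
  by rewrite /I /= in_itv /= a2 b1.
apply: contrapT => /forallNP hn; apply: hF; exists ((a, b), m) => //.
rewrite /F q0 => n /=.
have /existsNP[j /not_implyP[jm hj]] := hn n.
exists j => //; apply: contra_not hj; rewrite /I /= in_itv /= => /andP[h1 h2].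
by rewrite ler_norml; apply/andP; split; lra.
Qed.

(** Such an [l] needs weights arbitrarily close to [|l|], but almost surely all
    the weights avoid a neighbourhood of [|l|]. *)
Lemma not_essran_joint_approx_negligible l : ~ essran (X 0%N) (rnorm l) ->
  P.-negligible [set om | joint_approx_eigenvalue (T om) l].
Proof.
move=> /(not_essran_law Xid)[U [oU Ul U0]].
have /nbhs_ballP[r /= r0 rU] : nbhs (rnorm l) U by exact: open_nbhs_nbhs.
apply: (@negligibleS _ _ _ _ (\bigcup_n (X n @^-1` U))); last first.
  apply: negligible_bigcup => n; apply: law0_negligible => //.
  exact: open_measurable.
move=> om /= hl.
have [n hn] := weight_near_joint_approx he (bounded_operatorP (T om))
  (fun n => Xge0 n om) (hT om) hl r0.
by exists n => //=; apply: rU; rewrite /ball /= distrC.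
Qed.

End RandomShift.

Theorem theorem6p29 (R : realType) (d : measure_display)
    (Omega : measurableType d) (P : probability Omega R)
    (H : hilbertType R) (e : nat -> H) (he : orthonormal_basis e)
    (X : nat -> {RV P >-> R})
    (Xge0 : forall n omega, 0 <= X n omega)
    (Xbounded : forall n, exists M : R, forall omega, X n omega <= M)
    (Xindep : mutually_independent X)
    (Xid : identically_distributed X)
    (T : Omega -> bounded_operator H) (hT : random_weighted_shift e X T)
    (K : hilbertType R) (Ksep : separable K)
    (N : bounded_operator K) (hN : normal_operator N) :
  (measurable [set omega | lhd N (T omega)] /\
   P [set omega | lhd N (T omega)] =
     if `[< spectrum N `<=` [set z | essran (X 0%N) (complex.Re `|z|)] >]
     then 1%E else 0%E) /\
  (measurable [set omega | lhd (T omega) N] /\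
   P [set omega | lhd (T omega) N] =
     if `[< essran (X 0%N) = [set 0] /\ [set 0] `<=` spectrum N >]
     then 1%E else 0%E).
Proof.
have mX n : measurable_fun setT (X n : Omega -> R) by exact: measurable_RV.
have E1 : [set omega | lhd N (T omega)] =
    [set omega | forall l, spectrum N l -> joint_approx_eigenvalue (T omega) l].
  by apply/seteqP; split=> om /= /(lhd_normalP _ hN).
have m1 : measurable [set omega | lhd N (T omega)].
  by rewrite E1; exact: (measurable_joint_approx he mX hT).
split.
  (* one point of the spectrum with modulus outside the support suffices *)
  split=> //; case: asboolP => [sub|/existsNP[l /not_implyP[Nl hl]]].
    apply: prob1_of_negligible => //.
    apply: negligibleS (ae_joint_approx Xindep Xid he hT).
    by rewrite E1; apply: subsetC => om /= h l /sub; exact: h.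
  apply/negligibleP => //.
  apply: negligibleS (not_essran_joint_approx_negligible Xid Xge0 he hT hl).
  by rewrite E1 => om /= h; exact: h.
have E2 : [set omega | lhd (T omega) N] =
    if `[< spectrum N 0 >] then \bigcap_n (X n @^-1` [set 0]) else set0.
  have lhdE om := lhd_shift_normalP he (fun n => Xge0 n om) (hT om) hN.
  apply/seteqP; case: asboolP => h; split=> om //=.
  - by move=> /lhdE[h0 _] n _; exact: h0.
  - by move=> h0; apply/lhdE; split=> // n; exact: h0.
  - by move=> /lhdE[].
rewrite E2; case: asboolP => N0.
  split; first exact: measurable_all0.
  rewrite (prob_all0 Xindep Xid); congr (if _ then _ else _).
  by apply: asbool_equiv_eq; split=> [->|[->]] //; split=> // z ->.
split; first exact: measurable0.
rewrite measure0; case: asboolP => // -[_ /(_ 0 erefl)].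
by move/N0.
Qed.
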